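(* For $j,k\in\mathbb{N}=\{0,1,2,\dots\}$ let $$g_{j,k}:=\int_0^\infty x^{j}(\log x)^ke^{-x}\,dx ,$$ and let $b>0$. For each positive integer $n$: 1. The matrix $G^{(n)}:=(g_{j,k})_{0\le j,k\le n-1}$ is invertible. 2. Let $\{\lambda_1^{(n)},\dots,\lambda_n^{(n)}\}$ be the point process for which the vector $(\lambda_1^{(n)},\dots,\lambda_n^{(n)})$ has density with respect to Lebesgue measure on $\mathbb{R}^n$ $$\frac{1}{\prod_{j=1}^{n-1}j!}\,\frac{1}{\Gamma(b)^n}\,e^{-\sum_{j=1}^nx_j}\Big(\prod_{j=1}^nx_j^{b-1}\Big)\prod_{1\le i<j\le n}(x_i-x_j)(\log x_i-\log x_j)\,\mathbf{1}_{x_1>x_2>\cdots>x_n>0}.$$ This point process is determinantal with kernel $$K_n(x,y)=e^{-\frac{x+y}{2}}(xy)^{\frac{b-1}{2}}\sum_{j,k=1}^nc_{j-1,k-1}^{(n)}(\log y)^{j-1}x^{k-1},$$ where $(c_{j,k}^{(n)})_{0\le j,k\le n-1}$ is the inverse of $G^{(n)}$.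
   Context: A point process on $(0,\infty)$ is determinantal with kernel $K$ if for every $m\ge1$ its $m$-point correlation function with respect to Lebesgue measure is $\rho_m(x_1,\dots,x_m)=\det(K(x_i,x_j))_{1\le i,j\le m}$.
   Formalization: The moments are taken as g_{j,k} = ∫_0^∞ x^{j+b-1}(log x)^k e^{-x} dx, with the factor x^{b-1} added; without it part 2 fails, e.g. for n=1, b=3. The printed g_{j,k} and part 1 are the case b=1. *)

(* Defs.v *)
From HB Require Import structures.
From mathcomp Require Import all_boot all_order all_algebra.
From mathcomp Require Import all_classical all_reals all_analysis.
From mathcomp Require Import measurable_realfun.
Set Implicit Arguments.
Unset Strict Implicit.
Unset Printing Implicit Defensive.
Import Order.TTheory GRing.Theory Num.Theory.
Import numFieldNormedType.Exports.
Local Open Scope classical_set_scope.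
Local Open Scope ring_scope.

Section lebesgue_tuple.
Context {R : realType}.
Local Notation RT := (measurableTypeR R).
Local Open Scope ereal_scope.

Definition cons_pair n (p : RT * n.-tuple RT) : n.+1.-tuple RT :=
  [the n.+1.-tuple RT of p.1 :: p.2].

Definition uncons_pair n (t : n.+1.-tuple RT) : RT * n.-tuple RT :=
  (tnth t ord0, [tuple of behead t]).

Lemma cons_pairK n : cancel (@cons_pair n) (@uncons_pair n).
Proof. by move=> [x t]; congr pair; exact: val_inj. Qed.

Lemma measurable_cons_pair n :
  measurable_fun [set: RT * n.-tuple RT] (@cons_pair n).
Proof. exact: measurable_cons. Qed.

Lemma measurable_uncons_pair n :
  measurable_fun [set: n.+1.-tuple RT] (@uncons_pair n).
Proof.
apply/measurable_fun_pair; first exact: measurable_tnth.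
exact: measurable_behead.
Qed.

(* The library has no Lebesgue measure on R^n; it is built by induction on n as
   the image under consing of the product of the one-dimensional Lebesgue measure
   with the n-dimensional one. See lebesgue_tuple_box. *)
Section lebesgue_cons.
Context n (mu : {sigma_finite_measure set (n.-tuple RT) -> \bar R}).

Definition lebesgue_cons : set (n.+1.-tuple RT) -> \bar R :=
  pushforward (@lebesgue_measure R \x mu) (@cons_pair n).

Let lebesgue_cons0 : lebesgue_cons set0 = 0.
Proof. by rewrite /lebesgue_cons /pushforward preimage_set0 measure0. Qed.

Let lebesgue_cons_ge0 A : 0 <= lebesgue_cons A.
Proof. exact: integral_ge0. Qed.

Let lebesgue_cons_sigma_additive : semi_sigma_additive lebesgue_cons.
Proof.
move=> F mF tF mUF; rewrite /lebesgue_cons /pushforward preimage_bigcup.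
have mc A : measurable A -> measurable (@cons_pair n @^-1` A).
  by move=> mA; rewrite -[X in measurable X]setTI; exact: measurable_cons_pair.
apply: measure_semi_sigma_additive => [k||]; first exact: mc.
- apply/trivIsetP => i j _ _ ij; rewrite -preimage_setI.
  by move/trivIsetP : tF => -> //; rewrite preimage_set0.
- by rewrite -preimage_bigcup; exact: mc.
Qed.

HB.instance Definition _ := isMeasure.Build _ _ _ lebesgue_cons
  lebesgue_cons0 lebesgue_cons_ge0 lebesgue_cons_sigma_additive.

Let lebesgue_cons_sigma_finite : sigma_finite setT lebesgue_cons.
Proof.
have /sigma_finiteP[F [FT ndF Foo]] := sigma_finiteT (@lebesgue_measure R).
have /sigma_finiteP[G [GT ndG Goo]] := sigma_finiteT mu.
exists (fun k => @uncons_pair n @^-1` (F k `*` G k)).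
  rewrite -preimage_bigcup; apply/esym/seteqP; split => // t _.
  have [i _ Fi] : (\bigcup_k F k) (uncons_pair t).1 by rewrite -FT.
  have [j _ Gj] : (\bigcup_k G k) (uncons_pair t).2 by rewrite -GT.
  exists (maxn i j) => //; split.
    by move: Fi; exact/subsetPset/ndF/leq_maxl.
  by move: Gj; exact/subsetPset/ndG/leq_maxr.
move=> k; have [mF Fk] := Foo k; have [mG Gk] := Goo k.
have mFG : measurable (F k `*` G k) by exact: measurableX.
split.
  by rewrite -[X in measurable X]setTI; exact: measurable_uncons_pair.
rewrite /lebesgue_cons /pushforward -comp_preimage.
rewrite (_ : _ \o _ = id); last by apply/funext => p /=; exact: cons_pairK.
rewrite preimage_id product_measure1E// lte_mul_pinfty//.
by rewrite ge0_fin_numE.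
Qed.

HB.instance Definition _ := Measure_isSigmaFinite.Build _ _ _ lebesgue_cons
  lebesgue_cons_sigma_finite.

End lebesgue_cons.

Fixpoint lebesgue_tuple n : {sigma_finite_measure set (n.-tuple RT) -> \bar R} :=
  if n is k.+1 then lebesgue_cons (lebesgue_tuple k)
  else dirac ([tuple] : 0.-tuple RT).

Lemma lebesgue_tuple_box n (A : 'I_n -> set RT) :
  (forall i, measurable (A i)) ->
  lebesgue_tuple n [set t | forall i, A i (tnth t i)] =
  \prod_(i < n) (@lebesgue_measure R (A i)).
Proof.
elim: n A => [|n IHn] A mA.
  by rewrite big_ord0 /= diracE mem_set// => -[].
rewrite big_ord_recl -(IHn (fun i => A (lift ord0 i)))//=.
rewrite -product_measure1E//=; last first.
  rewrite (_ : mkset _ =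
    \bigcap_(i in [set: 'I_n]) (@tnth n RT ^~ i @^-1` A (lift ord0 i))).
    apply: fin_bigcap_measurable => // i _.
    by rewrite -[X in measurable X]setTI; exact: measurable_tnth.
  by apply/seteqP; split => [t tA i _|t tA i]; exact: tA.
rewrite /lebesgue_cons /pushforward; congr (_ _).
apply/seteqP; split => [[x t] /= xtA|[x t] /= [Ax tA] i].
  split; first exact: (xtA ord0).
  by move=> i; have := xtA (lift ord0 i); rewrite tnthS.
case: (unliftP ord0 i) => [j ->|->]; last by [].
by have := tA j; rewrite /cons_pair/= tnthS.
Qed.

End lebesgue_tuple.

Section point_process.
Context {R : realType}.
Local Notation RT := (measurableTypeR R).
Local Open Scope ereal_scope.

Definition has_density n d (T : measurableType d) (P : probability T R)
    (X : {RV P >-> n.-tuple RT}) (p : n.-tuple RT -> R) : Prop :=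
  measurable_fun [set: n.-tuple RT] p /\
  forall A : set (n.-tuple RT), measurable A ->
    distribution P X A = \int[lebesgue_tuple n]_(x in A) (p x)%:E.

Definition pos_orthant m : set (m.-tuple RT) :=
  [set t | forall i, (0 < tnth t i :> R)%R].

(* A (simple) point process is a random locally finite set of points. It is
   required to lie in ]0, +oo[ only almost surely, because a density constrains
   the law of a random vector and not its value at every outcome. *)
Definition point_process_pos d (T : measurableType d) (P : probability T R)
    (Xi : T -> set RT) : Prop :=
  [/\ forall w (a c : R), (0 < a)%R -> finite_set (Xi w `&` `[a, c]),
      forall B : set RT, measurable B ->
        measurable_fun [set: T] (fun w => counting (Xi w `&` B) : \bar R) &
      {ae P, forall w, Xi w `<=` `]0%R, +oo[}].

Definition distinct_tuples m (S : set RT) : set (m.-tuple RT) :=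
  [set t : m.-tuple RT | uniq (t : seq R) /\ forall i, S (tnth t i)].

(* rho is the density of the m-th factorial moment measure, i.e. of the expected
   number of m-tuples of distinct points. The test functions f live on the whole
   space, whereas rho is integrated over the positive orthant only. *)
Definition correlation_function d (T : measurableType d) (P : probability T R)
    (Xi : T -> set RT) m (rho : m.-tuple RT -> R) : Prop :=
  measurable_fun (pos_orthant (m := m)) rho /\
  forall f : m.-tuple RT -> R,
    measurable_fun [set: m.-tuple RT] f -> (forall t, 0 <= f t)%R ->
    \int[P]_w (\esum_(t in distinct_tuples (m := m) (Xi w)) (f t)%:E) =
    \int[lebesgue_tuple m]_(t in pos_orthant (m := m)) (f t * rho t)%:E.

Definition determinantal d (T : measurableType d) (P : probability T R)
    (Xi : T -> set RT) (K : R -> R -> R) : Prop :=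
  point_process_pos P Xi /\
  forall m, (0 < m)%N ->
    correlation_function P Xi (fun x : m.-tuple RT =>
      \det (\matrix_(i < m, j < m) K (tnth x i) (tnth x j)))%R.

End point_process.

Section biorthogonal_gamma.
Context {R : realType}.
Local Notation RT := (measurableTypeR R).
Implicit Types (b x y : R) (n : nat).

Definition Gamma b : R :=
  \int[@lebesgue_measure R]_(x in `]0, +oo[) (x `^ (b - 1) * expR (- x)).

(* The factor x^(b-1) of the weight must appear in the moments; it disappears when
   b = 1. Without it the kernel below would be wrong already for n = 1, where
   the intensity is x^(b-1) e^(-x) / Gamma b and the kernel on the diagonal would
   be x^(b-1) e^(-x). *)
Definition log_moment b (j k : nat) : R :=
  \int[@lebesgue_measure R]_(x in `]0, +oo[)
    (x ^+ j * x `^ (b - 1) * ln x ^+ k * expR (- x)).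

Definition log_moment_mx b n : 'M[R]_n := \matrix_(j, k) log_moment b j k.

Definition chamber n : set (n.-tuple RT) :=
  [set x | (forall i, 0 < tnth x i :> R) /\
           (forall i j : 'I_n, (i < j)%N -> tnth x j < tnth x i :> R)].

Definition log_density b n (x : n.-tuple RT) : R :=
  (\prod_(1 <= j < n) (j`!)%:R)^-1 * (Gamma b ^+ n)^-1 *
  expR (- \sum_(i < n) (tnth x i : R)) *
  (\prod_(i < n) (tnth x i : R) `^ (b - 1)) *
  (\prod_(i < n) \prod_(j < n | (i < j)%N)
     (((tnth x i : R) - tnth x j) * (ln (tnth x i : R) - ln (tnth x j : R)))) *
  \1_(chamber (n := n)) x.

(* Rows of log_moment_mx carry the powers of x and columns those of ln x, so rows
   of its inverse go with ln y and columns with x. *)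
Definition log_kernel b n x y : R :=
  expR (- ((x + y) / 2)) * (x * y) `^ ((b - 1) / 2) *
  \sum_(j < n) \sum_(k < n)
    invmx (log_moment_mx b n) j k * ln y ^+ j * x ^+ k.

End biorthogonal_gamma.

(* Main.v *)
Require Import Defs.
From HB Require Import structures.
From mathcomp Require Import all_boot all_order all_algebra fingroup perm.
From mathcomp Require Import all_classical all_reals all_analysis.
From mathcomp Require Import measurable_realfun ring lra zify.
From mathcomp Require polyrcf.
Set Implicit Arguments.
Unset Strict Implicit.
Unset Printing Implicit Defensive.
Import Order.TTheory GRing.Theory Num.Theory.
Import numFieldNormedType.Exports.
Local Open Scope classical_set_scope.
Local Open Scope ring_scope.

(** Put [h x = e^(-x/2) x^((b-1)/2)] on the positive half-line, extended by [0],
    and let [u_k x = h x * x^k] and [v_j x = h x * (ln x)^j] for [j, k < n].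
    The moment matrix [G] is the Gram matrix of [u] against [v], and on the
    positive half-line the kernel of the theorem is
    [K x y = \sum_(j, k) (G^-1)_(j,k) (v_j y) (u_k x)].

    Invertibility ([log_moment_mx_unit]). A row vector in the kernel of [G] is a
    polynomial [P] of size at most [n] with
    [\int P(x) Q(ln x) h(x)^2 dx = 0] for every polynomial [Q] of size at most
    [n]. Let [r_1, r_2, ..] be the positive roots of [P], with multiplicity, and
    take for [Q] the product of the [X - ln r_i]. Since [ln] is increasing,
    [(x - r_i)(ln x - ln r_i) >= 0], and the cofactor of [P] has no positive
    root, hence a constant sign. So the integrand has a constant sign and
    vanishes at finitely many positive points only, which is absurd.

    Correlation functions. Let [rho_m] be the determinant of the matrix
    [K (x_i) (x_j)] of size [m]. The two families being dual through [G^-1], [K]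
    is a reproducing kernel of trace [n]; expanding a determinant along its
    first row and column ([det_border]) then gives
    [\int rho_(m+1)(z, t) dz = (n - m) rho_m(t)] ([Rintegral_det_kernel_cons]).
    By two Vandermonde determinants, the unordered density [V] is a constant
    [c] times [det (u_k (x_i)) * det (v_j (x_i))], which equals
    [c * det G * rho_n] ([biorth_density_kernel]). Symmetrizing the sum of a
    test function over the distinct [m]-tuples of points reduces its expectation
    to an integral of [f] against [V] with [n - m] variables integrated out
    ([sum_integral_injections]), that is to
    [c * det G * \int f rho_m]. For [m = 0] and [f = 1] this says that
    [c * det G = 1] ([density_const_det]): the value of the normalizing constant
    follows from the total mass being [1], and [det G] is never computed. For
    [m > n] both sides vanish.

    Tonelli needs [rho_m >= 0], hence the sign of [det G]. It comes from the
    same recursion: [det G * rho_n >= 0] propagates downwards to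
    [det G * rho_m >= 0], and [rho_0 = 1] ([det_log_moment_mx_gt0]). *)

(** * Determinants *)

(** Expansion of a determinant along its first row and first column. It is
    quadratic in the border, which makes it integrable term by term when the
    border carries one variable. *)
Lemma det_border (A : comPzRingType) k (M : 'M[A]_k.+1) :
  let N := row' ord0 (col' ord0 M) in
  \det M = M ord0 ord0 * \det N -
    \sum_i \sum_j M ord0 (lift ord0 j) * M (lift ord0 i) ord0 * cofactor N i j.
Proof.
move=> N; rewrite (expand_det_row M ord0) big_ord_recl.
rewrite {1}/cofactor expr0 mul1r exchange_big /= -sumrN; congr +%R.
apply: eq_bigr => j _; rewrite -sumrN /cofactor.
case: k M @N j => [|k] M N j; first by case: j.
rewrite (expand_det_col _ ord0) !mulr_sumr; apply: eq_bigr => i _.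
rewrite !mxE.
have -> : lift (lift ord0 j) ord0 = ord0 by apply: val_inj.
rewrite /cofactor.
have -> : row' i (col' ord0 (row' ord0 (col' (lift ord0 j) M))) =
  row' i (col' j N).
  apply/matrixP => a c; rewrite !mxE; congr (fun_of_matrix M _ _).
  by apply: val_inj; rewrite /= /bump /= !add1n ltnS; case: leq.
rewrite /= !addn0 !add0n /bump /= add1n exprS exprD !mulN1r.
rewrite mulNr mulrN -!mulrA; congr (- (_ * _)).
by rewrite mulrCA; congr (_ * _); rewrite mulrCA.
Qed.

Lemma det_mulmx_lt (F : fieldType) m n (A : 'M[F]_(m, n)) (B : 'M[F]_(n, m)) :
  (n < m)%N -> \det (A *m B) = 0.
Proof.
move=> nm; apply: contraTeq nm; rewrite -unitfE => AB.
have /eqP rAB : \rank (A *m B) == m by rewrite -/(row_free _) row_free_unit unitmxE.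
by rewrite -leqNgt -[X in (X <= _)%N]rAB; apply: mulmx_max_rank.
Qed.

(** * Kernels of biorthogonal families *)

Section lincomb.
Context d (T : measurableType d) (R : realType) (mu : {measure set T -> \bar R}).
Context (I : eqType) (r : seq I) (a : I -> R) (f : I -> T -> R).
Context (intf : forall i, i \in r -> mu.-integrable setT (EFin \o f i)).

Lemma integrable_lincomb :
  mu.-integrable setT (EFin \o (fun x => \sum_(i <- r) a i * f i x)).
Proof.
rewrite (_ : _ \o _ = fun x => (\sum_(i <- r) (a i)%:E * (f i x)%:E)%E); last first.
  by apply/funext => x /=; rewrite -sumEFin.
under eq_fun do rewrite big_seq_cond.
apply: integrable_sum => // i; rewrite andbT => ir.
by apply: integrableZl => //; exact: intf.
Qed.

End lincomb.

Lemma Rintegral_lincomb d (T : measurableType d) (R : realType)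
    (mu : {measure set T -> \bar R}) (I : eqType) (r : seq I) (a : I -> R)
    (f : I -> T -> R) :
  (forall i, i \in r -> mu.-integrable setT (EFin \o f i)) ->
  \int[mu]_x (\sum_(i <- r) a i * f i x) = \sum_(i <- r) a i * \int[mu]_x f i x.
Proof.
elim: r => [|i r IH] intf.
  rewrite big_nil (_ : (fun _ => _) = cst 0); last first.
    by apply/funext => x; rewrite big_nil.
  by rewrite /Rintegral integral0.
have intr j : j \in r -> mu.-integrable setT (EFin \o f j).
  by move=> jr; apply: intf; rewrite inE jr orbT.
have inti : mu.-integrable setT (EFin \o f i) by apply: intf; rewrite mem_head.
rewrite big_cons -IH// -RintegralZl//.
under eq_Rintegral do rewrite big_cons.
rewrite RintegralD//.
  exact: (integrableZl measurableT (a i) inti).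
exact: integrable_lincomb.
Qed.

Section biorthogonal.
Context {R : realType} {n : nat} (u v : 'I_n -> measurableTypeR R -> R).
Local Notation mu := (@lebesgue_measure R).

(** Gram matrix of the families [u] and [v] for the Lebesgue measure on the
    whole line; functions living on a part of the line are extended by [0]. *)
Definition gram : 'M[R]_n := \matrix_(i, j) \int[mu]_z (u i z * v j z).

(** Kernel of the (oblique) projection onto the span of [u] along the
    orthogonal of [v]. The rows of the inverse Gram matrix go with [v] and its
    columns with [u]. *)
Definition biorth_kernel (x y : R) : R :=
  \sum_j \sum_k invmx gram j k * v j y * u k x.

(** Matrix of the values of a kernel at the coordinates of a tuple; its
    determinant is the candidate correlation function. *)
Definition kernel_mx (K : R -> R -> R) m (t : m.-tuple (measurableTypeR R)) :
  'M[R]_m := \matrix_(i, j) K (tnth t i) (tnth t j).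

Local Notation K := biorth_kernel.

(** With as many points as functions, the determinant factors through square
    matrices. *)
Lemma det_kernel_mx_full (t : n.-tuple (measurableTypeR R)) :
  \det (kernel_mx K t) =
  (\det gram)^-1 * \det (\matrix_(i, k) u k (tnth t i)) *
  \det (\matrix_(i, j) v j (tnth t i)).
Proof.
have -> : kernel_mx K t = (\matrix_(i, k) u k (tnth t i)) *m (invmx gram)^T *m
    (\matrix_(i, j) v j (tnth t i))^T.
  apply/matrixP => i j; rewrite !mxE; apply: eq_bigr => k _.
  rewrite !mxE mulr_suml; apply: eq_bigr => l _.
  by rewrite !mxE; ring.
by rewrite !det_mulmx !det_tr det_inv; ring.
Qed.

(** The kernel has rank at most [n], so more than [n] points give a singular
    matrix. *)
Lemma det_kernel_mx_gt m (t : m.-tuple (measurableTypeR R)) : (n < m)%N ->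
  \det (kernel_mx K t) = 0.
Proof.
move=> nm.
have -> : kernel_mx K t = (\matrix_(i < m, k < n) u k (tnth t i)) *m
    ((invmx gram)^T *m (\matrix_(i < m, j < n) v j (tnth t i))^T).
  apply/matrixP => i j; rewrite mulmxA !mxE; apply: eq_bigr => k _.
  rewrite !mxE mulr_suml; apply: eq_bigr => l _.
  by rewrite !mxE; ring.
exact: det_mulmx_lt.
Qed.

Context (int_uv : forall i j, mu.-integrable setT (EFin \o (fun z => u i z * v j z))).
Context (gram_unit : gram \in unitmx).


(** Coordinates of [K x] on the family [v]. *)
Let P x j : R := \sum_k invmx gram j k * u k x.
(** Coordinates of [K^~ y] on the family [u]. *)
Let Q y k : R := \sum_j invmx gram j k * v j y.

Let KP x y : K x y = \sum_j P x j * v j y.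
Proof.
apply: eq_bigr => j _; rewrite mulr_suml; apply: eq_bigr => k _.
by rewrite mulrAC.
Qed.

Let KQ x y : K x y = \sum_k Q y k * u k x.
Proof.
rewrite /K exchange_big; apply: eq_bigr => j _; rewrite mulr_suml.
by apply: eq_bigr.
Qed.

Let QG y j : \sum_k Q y k * gram k j = v j y.
Proof.
under eq_bigr do rewrite mulr_suml.
rewrite exchange_big /= (bigD1 j) //= [X in _ + X]big1 ?addr0.
  under eq_bigr do rewrite mulrAC.
  rewrite -mulr_suml; have /matrixP/(_ j j) := mulVmx gram_unit.
  by rewrite !mxE eqxx => ->; rewrite mul1r.
move=> l lj; under eq_bigr do rewrite mulrAC.
rewrite -mulr_suml; have /matrixP/(_ l j) := mulVmx gram_unit.
by rewrite !mxE (negbTE lj) => ->; rewrite mul0r.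
Qed.

Let mulK x y z : K x z * K z y =
  \sum_(p <- index_enum ('I_n * 'I_n)%type) (Q y p.1 * P x p.2) * (u p.1 z * v p.2 z).
Proof.
rewrite mulrC KQ KP mulr_suml.
rewrite -(pair_big xpredT xpredT (fun i j => Q y i * P x j * (u i z * v j z))) /=.
apply: eq_bigr => i _; rewrite mulr_sumr; apply: eq_bigr => j _; ring.
Qed.

Let diagK z : K z z =
  \sum_(p <- index_enum ('I_n * 'I_n)%type) invmx gram p.2 p.1 * (u p.1 z * v p.2 z).
Proof.
rewrite -(pair_big xpredT xpredT (fun i j => invmx gram j i * (u i z * v j z))) /=.
rewrite /K exchange_big; apply: eq_bigr => i _; apply: eq_bigr => j _; ring.
Qed.

Lemma integrable_biorth_kernel_mul x y :
  mu.-integrable setT (EFin \o (fun z => K x z * K z y)).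
Proof.
under eq_fun do rewrite mulK.
by apply: integrable_lincomb => p _; exact: int_uv.
Qed.

(** The reproducing property. *)
Lemma biorth_kernel_repr x y : \int[mu]_z (K x z * K z y) = K x y.
Proof.
under eq_Rintegral do rewrite mulK.
rewrite Rintegral_lincomb; last by move=> p _; exact: int_uv.
under eq_bigr => p _.
  have -> : \int[mu]_z (u p.1 z * v p.2 z) = gram p.1 p.2 by rewrite mxE.
  over.
rewrite -(pair_big xpredT xpredT (fun i j => Q y i * P x j * gram i j)) /=.
rewrite exchange_big KP /=; apply: eq_bigr => j _.
rewrite -[in RHS]QG mulr_sumr; apply: eq_bigr => i _; ring.
Qed.

Lemma integrable_biorth_kernel_diag :
  mu.-integrable setT (EFin \o (fun z => K z z)).
Proof.
under eq_fun do rewrite diagK.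
by apply: integrable_lincomb => p _; exact: int_uv.
Qed.

Lemma biorth_kernel_trace : \int[mu]_z K z z = n%:R.
Proof.
under eq_Rintegral do rewrite diagK.
rewrite Rintegral_lincomb; last by move=> p _; exact: int_uv.
under eq_bigr => p _.
  have -> : \int[mu]_z (u p.1 z * v p.2 z) = gram p.1 p.2 by rewrite mxE.
  over.
rewrite -(pair_big xpredT xpredT (fun i j => invmx gram j i * gram i j)) /=.
rewrite exchange_big -[in RHS](mxtrace1 R n) -(mulVmx gram_unit) /mxtrace /=.
by apply: eq_bigr => j _; rewrite mxE.
Qed.

Let consE m (t : m.-tuple (measurableTypeR R)) z :
  \det (kernel_mx K [tuple of z :: t]) = \det (kernel_mx K t) * K z z -
    \sum_(p <- index_enum ('I_m * 'I_m)%type)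
      cofactor (kernel_mx K t) p.1 p.2 * (K (tnth t p.1) z * K z (tnth t p.2)).
Proof.
rewrite det_border.
have -> : row' ord0 (col' ord0 (kernel_mx K [tuple of z :: t])) = kernel_mx K t.
  by apply/matrixP => i j; rewrite !mxE !tnthS.
rewrite !mxE tnth0 mulrC; congr (_ - _).
rewrite -(pair_big xpredT xpredT (fun i j => cofactor (kernel_mx K t) i j *
  (K (tnth t i) z * K z (tnth t j)))) /=.
apply: eq_bigr => i _; apply: eq_bigr => j _; rewrite !mxE !tnthS !tnth0.
ring.
Qed.

Lemma integrable_det_kernel_cons m (t : m.-tuple (measurableTypeR R)) :
  mu.-integrable setT (EFin \o (fun z => \det (kernel_mx K [tuple of z :: t]))).
Proof.
under eq_fun do rewrite consE.
rewrite (_ : _ \o _ = (fun z => (\det (kernel_mx K t))%:E * (K z z)%:E)%E \-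
  (EFin \o fun z => \sum_(p <- index_enum ('I_m * 'I_m)%type)
    cofactor (kernel_mx K t) p.1 p.2 * (K (tnth t p.1) z * K z (tnth t p.2)))%R)%E //.
apply: integrableB => //.
  by apply: integrableZl => //; exact: integrable_biorth_kernel_diag.
by apply: integrable_lincomb => p _; exact: integrable_biorth_kernel_mul.
Qed.

(** By [det_border], the diagonal term contributes the trace [n] of the kernel,
    and the reproducing property turns the sum over the border into [m] row
    expansions of the smaller determinant. *)
Lemma Rintegral_det_kernel_cons m (t : m.-tuple (measurableTypeR R)) :
  \int[mu]_z \det (kernel_mx K [tuple of z :: t]) =
  (n%:R - m%:R) * \det (kernel_mx K t).
Proof.
under eq_Rintegral do rewrite consE.
rewrite RintegralB//; last 2 first.
- exact: (integrableZl measurableT (\det (kernel_mx K t)) integrable_biorth_kernel_diag).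
- by apply: integrable_lincomb => p _; exact: integrable_biorth_kernel_mul.
rewrite RintegralZl//; last exact: integrable_biorth_kernel_diag.
rewrite biorth_kernel_trace Rintegral_lincomb; last first.
  by move=> p _; exact: integrable_biorth_kernel_mul.
under eq_bigr do rewrite biorth_kernel_repr.
rewrite -(pair_big xpredT xpredT (fun i j => cofactor (kernel_mx K t) i j *
  (K (tnth t i) (tnth t j)))) /=.
rewrite mulrC mulrBl; congr (_ - _).
rewrite -[LHS](_ : \sum_(i < m) \det (kernel_mx K t) = _); last first.
  apply: eq_bigr => i _; rewrite (expand_det_row _ i).
  by apply: eq_bigr => j _; rewrite mxE mulrC.
by rewrite sumr_const card_ord mulr_natl.
Qed.

End biorthogonal.

(** * Lebesgue measure on tuples *)

Section lebesgue_tuple_theory.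
Context {R : realType}.
Local Notation RT := (measurableTypeR R).
Local Notation mu := (@lebesgue_measure R).
Local Open Scope ereal_scope.

(** Tonelli's theorem, the head of the tuple being integrated first. *)
Lemma integral_lebesgue_tuple_cons n (f : n.+1.-tuple RT -> \bar R) :
  measurable_fun setT f -> (forall t, 0 <= f t) ->
  \int[lebesgue_tuple n.+1]_t f t =
  \int[lebesgue_tuple n]_t \int[mu]_z f [tuple of z :: t].
Proof.
move=> mf f0.
have -> : \int[lebesgue_tuple n.+1]_t f t =
    \int[mu \x lebesgue_tuple n]_p (f \o @cons_pair R n) p.
  have := @ge0_integral_pushforward _ _ _ _ R _ (@measurable_cons_pair R n)
     (mu \x lebesgue_tuple n) setT f measurableT mf (fun t _ => f0 t).
  by rewrite preimage_setT.
rewrite fubini_tonelli2//.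
  exact: (measurableT_comp mf (@measurable_cons_pair R n)).
by move=> x; exact: f0.
Qed.

(** The tuple of the coordinates of [t] selected by [s]: a permuted tuple when
    [s] is a permutation, a subtuple when [s] is an injection. *)
Definition tuple_sub n m (s : 'I_m -> 'I_n) (t : n.-tuple RT) : m.-tuple RT :=
  [tuple tnth t (s i) | i < m].

Lemma tnth_tuple_sub n m (s : 'I_m -> 'I_n) t i :
  tnth (tuple_sub s t) i = tnth t (s i).
Proof. by rewrite tnth_mktuple. Qed.

Lemma measurable_tuple_sub n m (s : 'I_m -> 'I_n) :
  measurable_fun setT (tuple_sub s).
Proof.
apply/measurable_fun_tnthP => i.
rewrite (_ : _ \o _ = @tnth _ RT ^~ (s i)); first exact: measurable_tnth.
by apply/funext => t /=; rewrite tnth_tuple_sub.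
Qed.

(** The product of the sets [A i]. *)
Definition box n (A : 'I_n -> set RT) : set (n.-tuple RT) :=
  [set t | forall i, A i (tnth t i)].

Lemma measurable_box n (A : 'I_n -> set RT) :
  (forall i, measurable (A i)) -> measurable (box A).
Proof.
move=> mA.
rewrite (_ : box A = \bigcap_(i in [set: 'I_n]) (@tnth n RT ^~ i @^-1` A i)).
  apply: fin_bigcap_measurable => // i _.
  by rewrite -[X in measurable X]setTI; exact: measurable_tnth.
by apply/seteqP; split => [t tA i _|t tA i]; exact: tA.
Qed.

Lemma lebesgue_tuple_boxE n (A : 'I_n -> set RT) :
  (forall i, measurable (A i)) ->
  lebesgue_tuple n (box A) = \prod_(i < n) mu (A i).
Proof. exact: lebesgue_tuple_box. Qed.

Lemma measurable_tuple_generated n :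
  @measurable _ (n.-tuple RT) =
  <<s [set box A | A in [set A : 'I_n -> set RT | forall i, measurable (A i)]] >>.
Proof.
apply/seteqP; split.
  apply: smallest_sub; first exact: smallest_sigma_algebra.
  rewrite -bigcup_seq /= => _ [i _ [B mB <-]]; apply: sub_sigma_algebra.
  exists (fun j => if j == i then B else setT) => /=.
    by move=> j; case: ifP.
  rewrite setTI; apply/seteqP; split => [t /(_ i)|t tB j] /=.
    by rewrite eqxx.
  by case: eqP => // ->.
apply: smallest_sub; first exact: sigma_algebra_measurable.
by move=> _ [A mA <-]; exact: measurable_box.
Qed.

(** The two measures agree on boxes, which generate the measurable sets and are
    stable under intersection. *)
Lemma lebesgue_tuple_perm n (s : {perm 'I_n}) (A : set (n.-tuple RT)) :
  measurable A ->
  pushforward (lebesgue_tuple n) (tuple_sub s) A = lebesgue_tuple n A.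
Proof.
move=> mA.
have boxE B : tuple_sub s @^-1` box B = box (fun i => B (s^-1 i)%g).
  apply/seteqP; split => t /= Bt i.
    by have := Bt (s^-1 i)%g; rewrite tnth_tuple_sub permKV.
  by have := Bt (s i); rewrite tnth_tuple_sub permK.
pose m1 : {measure set (n.-tuple RT) -> \bar R} :=
  measure_function_pushforward__canonical__measure_function_Measure (lebesgue_tuple n)
    (measurable_tuple_sub s).
pose g (k : nat) : set (n.-tuple RT) :=
  box (fun=> [set` `](- k%:R : R)%R, (k%:R : R)%R[] : set RT).
apply: (@measure_unique _ R (n.-tuple RT) _ g
  (measurable_tuple_generated n) _ _ _ m1 (lebesgue_tuple n)) => //.
- move=> _ _ [B mB <-] [C mC <-]; exists (fun i => B i `&` C i) => /=.
    by move=> i; exact: measurableI.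
  apply/seteqP; split => [t tBC|t [tB tC] i]; last by split.
  by split=> i; have [] := tBC i.
- by move=> k; eexists; last by []; move=> i /=; exact: measurable_itv.
- apply/seteqP; split => // t _.
  pose x i : R := tnth t i.
  exists (\max_(i < n) Num.truncn `|x i|).+1%N => //= i.
  change (x i \in `](- (\max_(i < n) Num.truncn `|x i|).+1%:R : R)%R,
                    ((\max_(i < n) Num.truncn `|x i|).+1%:R : R)%R[).
  rewrite in_itv /= -ltr_norml.
  apply: (lt_le_trans (truncnS_gt _)).
  rewrite ler_nat ltnS; exact: (leq_bigmax i).
- move=> _ [B mB <-].
  rewrite [LHS](_ : _ = lebesgue_tuple n (tuple_sub s @^-1` box B))//.
  rewrite boxE lebesgue_tuple_boxE// [RHS]lebesgue_tuple_boxE//.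
  rewrite [RHS](reindex_inj (@perm_inj _ (s^-1)%g)) /=.
  by apply: eq_bigr.
- move=> k; rewrite [m1 _](_ : _ = lebesgue_tuple n (tuple_sub s @^-1` g k))//.
  rewrite boxE lebesgue_tuple_boxE; last by move=> i; exact: measurable_itv.
  rewrite (_ : \prod_(i < n) _ = (\prod_(i < n) (k%:R - - k%:R : R)%R)%:E) ?ltry//.
  rewrite -prodEFin; apply: eq_bigr => i _; rewrite lebesgue_measure_itv /=.
  rewrite lte_fin; case: ltP => // k0.
  have /eqP -> : (k%:R == 0 :> R)%R.
    by rewrite eq_le ler0n andbT; move: k0; rewrite -subr_ge0; lra.
  by rewrite !oppr0 addr0.
Qed.

Lemma ge0_integral_lebesgue_tuple_perm n (s : {perm 'I_n}) (f : n.-tuple RT -> \bar R) :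
  measurable_fun setT f -> (forall t, 0 <= f t) ->
  \int[lebesgue_tuple n]_t f (tuple_sub s t) = \int[lebesgue_tuple n]_t f t.
Proof.
move=> mf f0.
have := @ge0_integral_pushforward _ _ _ _ R _ (measurable_tuple_sub s)
     (lebesgue_tuple n) setT f measurableT mf (fun t _ => f0 t).
rewrite preimage_setT => <-; apply: eq_measure_integral => [|? A mA _].
  exact: measurable_tuple_sub.
exact: lebesgue_tuple_perm.
Qed.

End lebesgue_tuple_theory.

(** * Integrating out variables of a determinant *)

Section integrate_out.
Context {R : realType} {n : nat} (u v : 'I_n -> measurableTypeR R -> R).
Local Notation RT := (measurableTypeR R).
Local Notation mu := (@lebesgue_measure R).
Local Notation K := (biorth_kernel u v).
Context (meas_u : forall i, measurable_fun setT (u i)).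
Context (meas_v : forall i, measurable_fun setT (v i)).
Context (int_uv : forall i j, mu.-integrable setT (EFin \o (fun z => u i z * v j z))).
Context (gram_unit : gram u v \in unitmx).

Lemma measurable_det d (T : measurableType d) m (M : T -> 'M[R]_m) :
  (forall i j, measurable_fun setT (fun x => M x i j)) ->
  measurable_fun setT (fun x => \det (M x)).
Proof.
move=> mM; apply: measurable_sum => s; apply: measurable_funM => //.
by apply: measurable_prod => i _; exact: mM.
Qed.

Lemma measurable_det_kernel_mx m :
  measurable_fun setT (fun t : m.-tuple RT => \det (kernel_mx K t)).
Proof.
apply: measurable_det => i j; under eq_fun do rewrite mxE.
apply: measurable_sum => k; apply: measurable_sum => l.
apply: measurable_funM; last exact: measurableT_comp (meas_u l) (measurable_tnth i).
apply: measurable_funM => //.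
exact: measurableT_comp (meas_v k) (measurable_tnth j).
Qed.

(** Positivity goes down from [n] points to fewer, by integrating variables out.
    The factor [eps] makes the lemma usable before the sign of the determinants
    is known: its instance [m = 0] reads [0 <= eps]. *)
Lemma det_kernel_mx_ge0 (eps : R) :
  (forall t : n.-tuple RT, 0 <= eps * \det (kernel_mx K t)) ->
  forall m (t : m.-tuple RT), (m <= n)%N -> 0 <= eps * \det (kernel_mx K t).
Proof.
move=> Hn m t /subnK; move: (n - m)%N => k; elim: k m t => [|k IH] m t.
  by rewrite add0n => mn; subst m.
rewrite addSnnS => kmn.
have : 0 <= \int[mu]_z (eps * \det (kernel_mx K [tuple of z :: t])).
  by apply: Rintegral_ge0 => z _; exact: IH.
rewrite RintegralZl//; last exact: integrable_det_kernel_cons.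
rewrite Rintegral_det_kernel_cons// mulrCA pmulr_rge0//.
by rewrite subr_gt0 ltr_nat -kmn ltn_addl.
Qed.

Context (det_ge0 : forall m (t : m.-tuple RT), (m <= n)%N ->
  0 <= \det (kernel_mx K t)).

(** Integrating out the first [k] of [k + m] variables, one at a time, produces
    the factors [n - m], [n - m - 1], ..., [n - m - k + 1]. *)
Lemma integral_det_kernel_mx_shift k m (f : m.-tuple RT -> R) :
  (k + m <= n)%N -> measurable_fun setT f -> (forall t, 0 <= f t) ->
  (\int[lebesgue_tuple (k + m)]_x
    (f (tuple_sub (@rshift k m) x) * \det (kernel_mx K x))%:E =
  ((n - m) ^_ k)%:R%:E *
  \int[lebesgue_tuple m]_t (f t * \det (kernel_mx K t))%:E)%E.
Proof.
move=> + mf f0; elim: k => [|k IH] kmn.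
  rewrite mul1e; apply: eq_integral => t _; congr (f _ * _)%:E.
  apply: eq_from_tnth => i; rewrite tnth_tuple_sub; congr tnth; exact: val_inj.
rewrite integral_lebesgue_tuple_cons; last 2 first.
- apply/measurable_EFinP; apply: measurable_funM.
    exact: measurableT_comp mf (measurable_tuple_sub _).
  exact: measurable_det_kernel_mx.
- by move=> t; rewrite lee_fin mulr_ge0// det_ge0.
under eq_integral => t _.
  have -> : (\int[mu]_z (f (tuple_sub (@rshift k.+1 m) [tuple of z :: t]) *
      \det (kernel_mx K [tuple of z :: t]))%:E)%E =
    ((n - m - k)%:R%:E * (f (tuple_sub (@rshift k m) t) * \det (kernel_mx K t))%:E)%E.
    have subE z : tuple_sub (@rshift k.+1 m) [tuple of z :: t] =
        tuple_sub (@rshift k m) t.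
      apply: eq_from_tnth => i; rewrite !tnth_tuple_sub.
      rewrite -(tnthS z t (rshift k i)); congr tnth; exact: val_inj.
    under eq_integral do rewrite subE EFinM.
    rewrite integralZl//; last exact: integrable_det_kernel_cons.
    rewrite -[X in (_ * X)%E]fineK; last first.
      apply: integrable_fin_num => //; exact: integrable_det_kernel_cons.
    rewrite [fine _](_ : _ = (n%:R - (k + m)%:R) * \det (kernel_mx K t)); last first.
      exact: Rintegral_det_kernel_cons.
    rewrite -!EFinM; congr EFin.
    rewrite natrB; last by lia.
    rewrite natrB; last by lia.
    rewrite natrD; ring.
  over.
rewrite ge0_integralZl//; last 2 first.
- apply/measurable_EFinP; apply: measurable_funM.
    exact: measurableT_comp mf (measurable_tuple_sub _).
  exact: measurable_det_kernel_mx.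
- by move=> t _; rewrite lee_fin mulr_ge0// det_ge0// ltnW.
rewrite IH; last exact: ltnW.
by rewrite muleA -EFinM -natrM mulnC ffactnSr.
Qed.

End integrate_out.

(** * Convergence of the logarithmic moments *)

Section log_moment_integrable.
Context {R : realType}.
Local Notation mu := (@lebesgue_measure R).

Lemma continuous_powR_gt0 (a x : R) : 0 < x -> {for x, continuous (@powR R ^~ a)}.
Proof.
move=> x0; apply: differentiable_continuous; apply/derivable1_diffP.
by apply: derivable_powR; rewrite in_itv /= andbT.
Qed.

Lemma integral_powR_le (a c : R) : 0 < a -> 0 < c < 1 ->
  (\int[mu]_(x in `[c, 1%R]) (x `^ (a - 1))%:E <= a^-1%:E)%E.
Proof.
move=> a0 /andP[c0 c1].
rewrite (@continuous_FTC2 R _ (fun x => a^-1 * x `^ a) c 1)//.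
- rewrite -EFinB lee_fin powR1 mulr1 gerBl mulr_ge0 ?invr_ge0 ?powR_ge0//.
  exact: ltW.
- apply: continuous_in_subspaceT => x; rewrite inE /= in_itv /= => /andP[cx _].
  by apply: continuous_powR_gt0; exact: lt_le_trans cx.
- have cP (x : R) : 0 < x -> a^-1 * y `^ a @[y --> x] --> a^-1 * x `^ a.
    by move=> x0; apply: cvgMr; exact: continuous_powR_gt0.
  split.
  + move=> x; rewrite in_itv /= => /andP[cx _]; apply: derivableM => //.
    by apply: derivable_powR; rewrite in_itv /= andbT (lt_trans c0).
  + by apply: cvg_at_right_filter; exact: cP.
  + by apply: cvg_at_left_filter; exact: cP.
- move=> x; rewrite in_itv /= => /andP[cx _]; have x0 := lt_trans c0 cx.
  have := is_derive1_powR a x0 => dx.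
  rewrite derive1E deriveM// derive_cst scaler0 addr0 derive_val.
  by rewrite /GRing.scale /= mulrA mulVf ?mul1r// gt_eqF.
Qed.

Lemma integrable_powR01 (a : R) : 0 < a ->
  mu.-integrable `]0, 1] (fun x => (x `^ (a - 1))%:E).
Proof.
move=> a0; have mP D : measurable_fun D (fun x : R => (x `^ (a - 1))%:E).
  apply/measurable_EFinP; apply: measurable_funTS; exact: measurable_powR.
apply/integrableP; split; first exact: mP.
under eq_integral do rewrite gee0_abs ?lee_fin ?powR_ge0//.
(* With i.+2, the lower bound is less than 1 even for i = 0. *)
pose F (i : nat) : set R := `[i.+2%:R^-1, 1]%classic.
have -> : `]0, 1]%classic = \bigcup_i F i.
  apply/seteqP; split => [x|x [i _]] /=; rewrite /F /= !in_itv /=.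
    move=> /andP[x0 x1]; exists (Num.truncn x^-1) => //=.
    rewrite in_itv /= x1 andbT invf_ple ?posrE//.
    apply/ltW/(lt_le_trans (truncnS_gt _)); by rewrite ler_nat.
  move=> /andP[ix ->]; rewrite andbT; apply: lt_le_trans ix.
  by rewrite invr_gt0.
have ndF : nondecreasing_seq F.
  move=> i j ij; apply/subsetPset => x; rewrite /F /= !in_itv /= => /andP[ix ->].
  by rewrite andbT; apply: le_trans ix; rewrite lef_pV2 ?posrE// ler_nat.
have F0 i x : F i x -> (0 <= (x `^ (a - 1))%:E)%E by rewrite lee_fin powR_ge0.
have cvF : (\int[mu]_(x in F i) (x `^ (a - 1))%:E @[i --> \oo] -->
    \int[mu]_(x in \bigcup_i F i) (x `^ (a - 1))%:E)%E.
  apply: ge0_nondecreasing_set_cvg_integral => // i; rewrite ?/F.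
    exact: measurable_itv.
  exact: mP.
rewrite -(cvg_lim _ cvF)//; apply: (@le_lt_trans _ _ (a^-1)%:E); last exact: ltry.
apply: lime_le; first by apply/cvg_ex; eexists; exact: cvF.
apply: nearW => i; apply: integral_powR_le => //.
by rewrite invr_gt0 ltr0n /= invf_lt1// ltr1n.
Qed.

Lemma abs_ln_le (d x : R) : 0 < d -> 0 < x <= 1 -> `|ln x| <= d^-1 * x `^ (- d).
Proof.
move=> d0 /andP[x0 x1]; rewrite ler0_norm ?ln_le0//.
(* This is ln y < y at y = x^(-d). *)
rewrite mulrC ler_pdivlMr// -ler_expR.
have := ltW (ln_sublinear (powR_gt0 (- d) x0)); rewrite ln_powR.
by rewrite ler_expR mulNr mulNr (mulrC d).
Qed.

(** Near [0], the power of the logarithm costs at most half of the exponent [b]. *)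
Lemma log_moment_bound01 (b x : R) (j k : nat) : 0 < b -> 0 < x <= 1 ->
  `|x ^+ j * x `^ (b - 1) * ln x ^+ k * expR (- x)| <=
  (b / (2 * k.+1%:R))^-1 ^+ k * x `^ (b / 2 - 1).
Proof.
(* The exponent d satisfies d * k <= b / 2. *)
move=> b0 /[dup] x01 /andP[x0 x1]; set d := b / _.
have d0 : 0 < d by rewrite divr_gt0// mulr_gt0// ltr0n.
have lnk : `|ln x| ^+ k <= d^-1 ^+ k * x `^ (- (b / 2)).
  apply: (@le_trans _ _ ((d^-1 * x `^ (- d)) ^+ k)).
    by rewrite lerXn2r ?nnegrE ?abs_ln_le// mulr_ge0 ?powR_ge0// invr_ge0 ltW.
  rewrite exprMn ler_wpM2l ?exprn_ge0 ?invr_ge0 ?(ltW d0)//.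
  rewrite -powR_mulrn ?powR_ge0// -powRrM; apply: ger_powR; first exact: x01.
  have -> : d = b / 2 / k.+1%:R by rewrite /d invfM mulrA.
  rewrite mulNr lerN2 mulrAC ler_pdivrMr ?ltr0n//.
  by rewrite ler_wpM2l ?divr_ge0 ?(ltW b0)// ler_nat.
rewrite !normrM (ger0_norm (expR_ge0 _)) (ger0_norm (powR_ge0 _ _)).
rewrite !normrX (gtr0_norm x0).
apply: (@le_trans _ _ (1 * x `^ (b - 1) * (d^-1 ^+ k * x `^ (- (b / 2))) * 1)).
  rewrite ler_pM ?expR_ge0//.
  - by rewrite !mulr_ge0 ?exprn_ge0 ?powR_ge0// ltW.
  - apply: ler_pM; rewrite ?mulr_ge0 ?exprn_ge0 ?powR_ge0// ?(ltW x0)//.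
    by rewrite ler_wpM2r ?powR_ge0// exprn_ile1// ltW.
  - by rewrite expR_le1 oppr_le0 ltW.
rewrite mulr1 mul1r mulrCA -powRD; last by rewrite (gt_eqF x0) implybT.
by rewrite le_eqVlt; apply/orP; left; apply/eqP; congr (_ * _ `^ _); lra.
Qed.

Lemma exprn_le_expR_half (N : nat) (x : R) : 1 <= x ->
  x ^+ N <= (2 ^+ N.+1 * (N.+1)`!%:R) * expR (x / 2).
Proof.
move=> x1; have x0 : 0 <= x by exact: le_trans x1.
apply: (@le_trans _ _ (x ^+ N.+1)); first by rewrite ler_weXn2l.
(* A single term of the exponential series suffices. *)
have := @expR_ge1Dxn R (x / 2) N (divr_ge0 x0 (ler0n R 2)).
move=> /(le_trans _)-/(_ (((x / 2) ^+ N.+1) / (N.+1)`!%:R)).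
rewrite lerDr ler01 => /(_ isT).
rewrite ler_pdivrMr ?ltr0n ?fact_gt0// expr_div_n ler_pdivrMr ?exprn_gt0//.
by rewrite -mulrA mulrC (mulrC (_ `!%:R)).
Qed.

(** For [x >= 1], everything but the exponential is at most a power of [x]. *)
Lemma log_moment_bound1y (b x : R) (j k : nat) : 1 <= x ->
  let N := (j + (Num.truncn b).+1 + k)%N in
  `|x ^+ j * x `^ (b - 1) * ln x ^+ k * expR (- x)| <=
  (2 ^+ N.+1 * (N.+1)`!%:R) * expR (- (2^-1) * x).
Proof.
move=> x1 /=; set N := (j + (Num.truncn b).+1 + k)%N.
have x0 : 0 < x by exact: lt_le_trans x1.
rewrite !normrM (ger0_norm (expR_ge0 _)) (ger0_norm (powR_ge0 _ _)).
rewrite !normrX (gtr0_norm x0) ger0_norm ?ln_ge0//.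
apply: (@le_trans _ _ (x ^+ N * expR (- x))).
  rewrite ler_wpM2r ?expR_ge0// /N !exprD.
  apply: ler_pM; rewrite ?mulr_ge0 ?exprn_ge0 ?powR_ge0 ?ln_ge0 ?(ltW x0)//.
    rewrite ler_wpM2l ?exprn_ge0 ?(ltW x0)//.
    rewrite -powR_mulrn ?(ltW x0)//; apply: ler_powR => //.
    have := truncnS_gt b; lra.
  by rewrite lerXn2r ?nnegrE ?ln_ge0 ?(ltW x0)// ltW// ln_sublinear.
have -> : - 2^-1 * x = x / 2 + - x by lra.
by rewrite expRD mulrA ler_wpM2r ?expR_ge0// exprn_le_expR_half.
Qed.

Lemma measurable_log_moment_integrand D (b : R) (j k : nat) :
  measurable_fun D (fun x : R => x ^+ j * x `^ (b - 1) * ln x ^+ k * expR (- x)).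
Proof.
apply: measurable_funTS; apply: measurable_funM.
  apply: measurable_funM; last first.
    by apply: measurable_funX; exact: measurable_ln.
  apply: measurable_funM; last exact: measurable_powR.
  exact: measurable_funX.
apply: measurableT_comp => //.
Qed.

Lemma integrable_log_moment (b : R) (j k : nat) : 0 < b ->
  mu.-integrable `]0, +oo[
    (fun x => (x ^+ j * x `^ (b - 1) * ln x ^+ k * expR (- x))%:E).
Proof.
move=> b0.
pose C1 : R := (b / (2 * k.+1%:R))^-1 ^+ k.
pose N := (j + (Num.truncn b).+1 + k)%N.
pose C2 : R := 2 * (2 ^+ N.+1 * (N.+1)`!%:R).
pose g1 : R -> R := (fun x => x `^ (b / 2 - 1)) \_ `]0, 1].
pose g2 : R -> R := exponential_pdf 2^-1.
have C10 : 0 <= C1 by rewrite exprn_ge0// invr_ge0 divr_ge0 ?(ltW b0)// mulr_ge0 ?ler0n.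
have C20 : 0 <= C2 by rewrite !mulr_ge0 ?exprn_ge0 ?ler0n.
have g10 x : 0 <= g1 x by apply: restrict_ge0 => ? _; exact: powR_ge0.
have g20 x : 0 <= g2 x by apply: exponential_pdf_ge0.
have Ig : mu.-integrable `]0, +oo[
    (fun x => C1%:E * (g1 x)%:E + C2%:E * (g2 x)%:E)%E.
  apply: (@integrableS _ _ _ _ setT) => //; apply: integrableD => //.
      apply: integrableZl => //.
      have -> : (fun x => (g1 x)%:E) =
          (fun x : R => (x `^ (b / 2 - 1))%:E) \_ `]0, 1].
        by apply/funext => x; rewrite /g1 /patch; case: ifP.
      have := integrable_powR01 (divr_gt0 b0 (ltr0n R 2)).
      have mI : measurable (`]0, 1]%classic : set (measurableTypeR R)).
        exact: measurable_itv.
      by move/(iffLR (@integrable_mkcond _ (measurableTypeR R) R mu _ _ mI)).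
    by apply: integrableZl => //; exact: integrable_exponential_pdf.
apply: le_integrable Ig => //.
- by apply/measurable_EFinP; exact: measurable_log_moment_integrand.
- move=> x /=; rewrite in_itv /= andbT => x0.
  rewrite lee_fin.
  rewrite [X in _ <= X]ger0_norm ?addr_ge0 ?mulr_ge0//.
  have [x1|x1] := leP x 1.
    apply: (le_trans (@log_moment_bound01 b x j k b0 _)); first by rewrite x0.
    rewrite /g1 patchE mem_set /= ?in_itv/= ?x0//.
    by rewrite lerDl mulr_ge0.
  apply: (le_trans (@log_moment_bound1y b x j k (ltW x1))).
  rewrite /g2 exponential_pdfE ?(ltW x0)// -/N.
  apply: (@le_trans _ _ (C2 * (2^-1 * expR (- 2^-1 * x)))).
    by rewrite /C2 mulrACA divff// mul1r.
  by rewrite lerDr mulr_ge0.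
Qed.

End log_moment_integrable.

(** * Invertibility of the moment matrix *)

Section moment_matrix.
Context {R : realType} (b : R) (n : nat).
Local Notation RT := (measurableTypeR R).
Local Notation mu := (@lebesgue_measure R).

(** Square root of the weight [x^(b-1) e^(-x)] on the positive half-line,
    extended by [0]. *)
Definition half_weight (x : R) : R :=
  \1_(`]0, +oo[%classic : set R) x * (expR (- (x / 2)) * x `^ ((b - 1) / 2)).

(** The two biorthogonal families; [half_weight] occurs in each of them, so that
    their products carry the full weight. *)
Definition power_fun (k : 'I_n) (x : RT) : R := half_weight x * x ^+ k.
Definition log_fun (k : 'I_n) (x : RT) : R := half_weight x * ln (x : R) ^+ k.

Lemma half_weight_gt0 x : 0 < x -> 0 < half_weight x.
Proof.
move=> x0; rewrite /half_weight indicE mem_set /= ?in_itv /= ?x0//.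
by rewrite mul1r mulr_gt0 ?expR_gt0 ?powR_gt0.
Qed.

Lemma half_weight_le0 x : x <= 0 -> half_weight x = 0.
Proof.
move=> x0; rewrite /half_weight indicE memNset ?mul0r//= in_itv /= andbT.
by rewrite ltNge x0.
Qed.

Lemma half_weight_sqr x : 0 < x ->
  half_weight x ^+ 2 = x `^ (b - 1) * expR (- x).
Proof.
move=> x0; rewrite /half_weight indicE mem_set /= ?in_itv /= ?x0//.
rewrite mul1r exprMn -expRM_natr -powR_mulrn ?powR_ge0// -powRrM mulrC.
by congr (_ `^ _ * expR _); field.
Qed.

Lemma measurable_half_weight : measurable_fun setT half_weight.
Proof.
apply: measurable_funM; first by apply: measurable_indic; exact: measurable_itv.
apply: measurable_funM; last exact: measurable_powR.
apply: measurableT_comp => //; apply: measurableT_comp => //.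
exact: measurable_funM.
Qed.

Lemma measurable_power_fun k : measurable_fun setT (power_fun k).
Proof.
apply: measurable_funM; first exact: measurable_half_weight.
exact: measurable_funX.
Qed.

Lemma measurable_log_fun k : measurable_fun setT (log_fun k).
Proof.
apply: measurable_funM; first exact: measurable_half_weight.
by apply: measurable_funX; exact: measurable_ln.
Qed.

Let power_logE i j x : power_fun i x * log_fun j x =
  ((fun x : R => x ^+ i * x `^ (b - 1) * ln x ^+ j * expR (- x)) \_ `]0, +oo[) x.
Proof.
rewrite patchE; case: ifPn => [|]; rewrite ?inE /=.
  rewrite in_itv /= andbT => x0.
  rewrite /power_fun /log_fun mulrACA -expr2 half_weight_sqr//; ring.
move/negP; rewrite inE /= in_itv /= andbT => /negP; rewrite -leNgt => x0.
by rewrite /power_fun half_weight_le0// !mul0r.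
Qed.

Lemma integrable_power_log i j : 0 < b ->
  mu.-integrable setT (EFin \o (fun z => power_fun i z * log_fun j z)).
Proof.
move=> b0.
have -> : EFin \o (fun z => power_fun i z * log_fun j z) = (fun x : RT =>
    ((x : R) ^+ i * x `^ (b - 1) * ln (x : R) ^+ j * expR (- (x : R)))%:E) \_ `]0, +oo[.
  by apply/funext => x; rewrite /= power_logE /patch; case: ifP.
have mI : measurable (`]0, +oo[%classic : set RT) by exact: measurable_itv.
apply/(@integrable_mkcond _ RT R mu _ _ mI).1; exact: integrable_log_moment.
Qed.

Lemma gram_power_log : gram power_fun log_fun = log_moment_mx b n.
Proof.
apply/matrixP => i j; rewrite !mxE /log_moment [RHS]Rintegral_mkcond.
by apply: eq_Rintegral => x _; rewrite power_logE.
Qed.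

(** Splitting off the positive roots of a polynomial, with multiplicity. *)
Lemma split_positive_roots (p : {poly R}) : p != 0 ->
  exists (r : seq R) (q : {poly R}),
    [/\ p = q * \prod_(a <- r) ('X - a%:P), all (fun a => 0 < a) r &
        forall x, 0 < x -> ~~ root q x].
Proof.
have [m] := ubnP (size p); elim: m p => // m IH p pm p0.
have [[x [x0 px]]|nx] := pselect (exists x, 0 < x /\ root p x); last first.
  exists [::], p; split => //; first by rewrite big_nil mulr1.
  by move=> x x0; apply/negP => px; apply: nx; exists x.
have /factor_theorem[q pE] := px.
have q0 : q != 0 by apply: contraNneq p0 => q0; rewrite pE q0 mul0r.
have [||r [q' [qE r0 q'0]]] := IH q => //.
  by move: pm; rewrite pE size_Mmonic ?monicXsubC// size_XsubC addn2 /= ltnS.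
exists (x :: r), q'; split => //=; last by rewrite x0.
by rewrite big_cons pE qE -mulrA; congr (_ * _); rewrite mulrC.
Qed.

(** A polynomial without positive root keeps the sign of its value at [1]. *)
Lemma poly_positive_sign (q : {poly R}) :
  (forall x, 0 < x -> ~~ root q x) -> forall x, 0 < x -> 0 < q.[1] * q.[x].
Proof.
move=> qr x x0; rewrite ltNge; apply/negP => q1x.
have [x1|x1] := leP 1 x.
  have [c] := polyrcf.poly_ivt x1 q1x; rewrite in_itv /= => /andP[c1 _].
  by apply/negP/qr; exact: lt_le_trans c1.
rewrite mulrC in q1x; have [c] := polyrcf.poly_ivt (ltW x1) q1x.
by rewrite in_itv /= => /andP[c1 _]; apply/negP/qr; exact: lt_le_trans c1.
Qed.

(** The logarithm is increasing, so [x - a] and [ln x - ln a] have the same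
    sign. *)
Lemma prod_roots_ln_sign (r : seq R) x : all (fun a => 0 < a) r -> 0 < x ->
  0 <= (\prod_(a <- r) ('X - a%:P)).[x] * (\prod_(a <- r) ('X - (ln a)%:P)).[ln x] /\
  (x \notin r ->
  0 < (\prod_(a <- r) ('X - a%:P)).[x] * (\prod_(a <- r) ('X - (ln a)%:P)).[ln x]).
Proof.
move=> /allP r0 x0; rewrite !horner_prod -big_split /=.
have pos a : 0 < a -> x != a -> 0 < ('X - a%:P).[x] * ('X - (ln a)%:P).[ln x].
  move=> a0; rewrite !hornerXsubC; have [xa _|xa _|//] := ltgtP x a.
    by rewrite nmulr_rgt0 ?subr_lt0// ltr_ln.
  by rewrite mulr_gt0// subr_gt0// ltr_ln.
split.
  rewrite big_seq; apply: prodr_ge0 => a /r0 a0.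
  have [->|] := eqVneq x a; first by rewrite hornerXsubC subrr mul0r.
  by move=> /(pos a a0)/ltW.
move=> xr; rewrite big_seq; apply: prodr_gt0 => a ar; apply: pos; first exact: r0.
by apply: contraNneq xr => ->.
Qed.

Lemma log_moment_mx_unit : 0 < b -> log_moment_mx b n \in unitmx.
Proof.
move=> b0; rewrite -gram_power_log unitmxE unitfE; apply/negP => /det0P[w w0 wG].
pose p := rVpoly w.
have p0 : p != 0.
  by apply: contraNneq w0 => p0; rewrite -(rVpolyK w) -/p p0 linear0.
have [r [q [pE r0 qr]]] := split_positive_roots p0.
have q0 : q != 0 by apply: contraNneq p0 => q0; rewrite pE q0 mul0r.
(* The function x |-> L.[ln x] changes sign at the same positive points as p. *)
pose L := \prod_(a <- r) ('X - (ln a)%:P) : {poly R}.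
have sL : (size L <= n)%N.
  rewrite size_prod_XsubC.
  have : (size p <= n)%N by exact: size_poly.
  rewrite pE size_Mmonic ?monic_prod_XsubC// size_prod_XsubC addnS /=.
  by apply: leq_trans; rewrite -add1n leq_add2r lt0n size_poly_eq0.
(* The factor q.[1] makes F nonnegative. *)
pose F x : R := \sum_(k <- index_enum ('I_n * 'I_n)%type)
  (q.[1] * (w ord0 k.1 * L`_k.2)) * (power_fun k.1 x * log_fun k.2 x).
have intF : mu.-integrable setT (EFin \o F).
  by apply: integrable_lincomb => k _; exact: integrable_power_log.
have IF : \int[mu]_x F x = 0.
  rewrite Rintegral_lincomb; last by move=> k _; exact: integrable_power_log.
  under eq_bigr => k _.
    have -> : \int[mu]_z (power_fun k.1 z * log_fun k.2 z) =
      gram power_fun log_fun k.1 k.2 by rewrite mxE.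
    over.
  rewrite -(pair_big xpredT xpredT (fun i j : 'I_n => q.[1] * (w ord0 i * L`_j) *
     gram power_fun log_fun i j)) /= exchange_big big1//= => j _.
  transitivity (q.[1] * L`_j * (w *m gram power_fun log_fun) ord0 j).
    rewrite mxE mulr_sumr; apply: eq_bigr => i _; ring.
  by rewrite wG mxE mulr0.
have FE x : F x = half_weight x ^+ 2 * (q.[1] * (p.[x] * L.[ln x])).
  rewrite /F -(pair_big xpredT xpredT (fun i j : 'I_n => q.[1] * (w ord0 i * L`_j) *
     (power_fun i x * log_fun j x))) /=.
  rewrite (horner_coef_wide _ sL) (@horner_coef_wide _ n p) ?size_poly//.
  rewrite mulr_suml !mulr_sumr; apply: eq_bigr => i _.
  rewrite !mulr_sumr; apply: eq_bigr => j _.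
  rewrite coef_rVpoly_ord /power_fun /log_fun; ring.
have pL x : q.[1] * (p.[x] * L.[ln x]) =
    (q.[1] * q.[x]) * ((\prod_(a <- r) ('X - a%:P)).[x] * L.[ln x]).
  by rewrite pE hornerM; ring.
have F0 x : 0 <= F x.
  rewrite FE; have [x0|x0] := leP x 0; first by rewrite half_weight_le0// expr0n mul0r.
  rewrite mulr_ge0 ?sqr_ge0// pL mulr_ge0//.
    exact/ltW/poly_positive_sign.
  by have [] := prod_roots_ln_sign r0 x0.
have Fpos x : 0 < x -> x \notin r -> 0 < F x.
  move=> x0 xr.
  rewrite FE mulr_gt0 ?exprn_gt0 ?half_weight_gt0// pL mulr_gt0//.
    exact: poly_positive_sign.
  by have [_] := prod_roots_ln_sign r0 x0; exact.
have : ae_eq mu setT (EFin \o F) (cst 0%E).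
  apply/ae_eq_integral_abs => //; first exact: (measurable_int _ intF).
  under eq_integral do rewrite /= ger0_norm//.
  move: IF; rewrite /Rintegral => IF.
  by rewrite -[LHS]fineK ?IF// (integrable_fin_num _ intF).
move=> [N [mN N0 sub]].
(* As the roots are positive, none of them exceeds their sum M. *)
pose M := \sum_(a <- r) a.
have rM a : a \in r -> a <= M.
  move=> ar; rewrite /M (big_rem a)//= lerDl big_seq sumr_ge0// => c /mem_rem cr.
  exact/ltW/(allP r0).
have M0 : 0 <= M by rewrite /M big_seq sumr_ge0// => c cr; exact/ltW/(allP r0).
have sN : `]M, M + 1[%classic `<=` N.
  move=> x /=; rewrite in_itv /= => /andP[Mx _]; apply: sub => /= /(_ I) [] Fx.
  have xr : x \notin r by apply/negP => /rM; rewrite leNgt Mx.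
  by have := Fpos x (le_lt_trans M0 Mx) xr; rewrite Fx ltxx.
have : (mu `]M, (M + 1)%R[%classic <= mu N)%E.
  by apply: le_measure => //; rewrite inE//; exact: measurable_itv.
by rewrite N0 lebesgue_measure_itv /= lte_fin ltrDl ltr01 -EFinB lee_fin; lra.
Qed.

End moment_matrix.

(** * Sums over the points of a random tuple *)

Section density.
Context d (T : measurableType d) (R : realType).
Local Open Scope ereal_scope.

(** The density [p] is not assumed nonnegative: it agrees almost everywhere with
    the Radon-Nikodym derivative. *)
Lemma integral_density (nu : {finite_measure set T -> \bar R})
    (mu : {sigma_finite_measure set T -> \bar R}) (p f : T -> \bar R) :
  measurable_fun setT p ->
  (forall A, measurable A -> nu A = \int[mu]_(x in A) p x) ->
  measurable_fun setT f -> (forall x, 0 <= f x) ->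
  \int[nu]_x f x = \int[mu]_x (f x * p x).
Proof.
move=> mp nup mf f0.
have numu : nu `<< mu.
  apply/null_content_dominatesP => A mA A0.
  by rewrite nup// null_set_integral//; exact: measurable_funTS.
rewrite -(Radon_Nikodym_SigmaFinite.change_of_variables numu)//.
have ig : mu.-integrable setT (Radon_Nikodym_SigmaFinite.f nu mu).
  exact: Radon_Nikodym_SigmaFinite.f_integrable.
have mg := measurable_int _ ig.
have gp : ae_eq mu setT (Radon_Nikodym_SigmaFinite.f nu mu) p.
  apply: integral_ae_eq => // E _ mE.
  by rewrite -nup// -Radon_Nikodym_SigmaFinite.f_integral.
apply: ae_eq_integral => //; [exact: emeasurable_funM..|].
by move: gp; apply: filterS => x /(_ I) ->.
Qed.

End density.

Section finite_sums.
Context {R : realType}.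

Lemma esum_fintype (I : finType) (J : pred I) (a : I -> R) :
  (forall i, 0 <= a i) ->
  \esum_(i in [set` J]) (a i)%:E = (\sum_(i | J i) a i)%:E.
Proof.
move=> a0; rewrite esum_fset; first last.
- by move=> i _; rewrite lee_fin.
- exact: finite_finset.
rewrite -sumEFin [RHS]bigfs ?index_enum_uniq// => i _.
by rewrite mem_index_enum.
Qed.

Lemma esum_fin_image (I : finType) (T : choiceType) (J : pred I) (e : I -> T)
    (a : T -> R) : {in J &, injective e} -> (forall t, 0 <= a t) ->
  \esum_(t in [set e i | i in [set` J]]) (a t)%:E = (\sum_(i | J i) a (e i))%:E.
Proof.
move=> einj a0; rewrite esum_image; first exact: esum_fintype.
move=> i j /set_mem iJ /set_mem jJ; exact: einj.
Qed.

Lemma counting_esum (T : choiceType) (S : set T) : finite_set S ->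
  counting S = \esum_(x in S) 1%:E :> \bar R.
Proof.
move=> Sf; rewrite /counting asboolT// esum_fset//.
by rewrite fsbig_finite// sumEFin big_const_seq count_predT iter_addr_0.
Qed.

End finite_sums.

Section point_sums.
Context {R : realType} {n : nat}.
Local Notation RT := (measurableTypeR R).
Implicit Types x : n.-tuple RT.

(** The coordinate at position [i] does not occur before. These positions
    enumerate without repetition the set of the coordinates of [x], which makes
    sums over this set measurable in [x] without excluding repeated
    coordinates. *)
Definition first_occ x (i : 'I_n) : bool :=
  [forall k : 'I_n, (k < i)%N ==> ((tnth x k : R) != tnth x i)].

(** The set of the coordinates of a tuple. *)
Definition points x : set RT := [set y : R | y \in (x : seq R)].

Lemma first_occ_inj x : {in first_occ x &, injective (@tnth n R x)}.
Proof.
move=> i j /forallP ix /forallP jx xij; apply: val_inj.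
have [ij|ji|//] := ltngtP i j.
  by have /implyP/(_ ij) := jx i; rewrite xij eqxx.
by have /implyP/(_ ji) := ix j; rewrite xij eqxx.
Qed.

Lemma points_first_occ x y : points x y -> exists2 i, first_occ x i & tnth x i = y.
Proof.
move=> yx; have ix : (index (y : R) (x : seq R) < n)%N.
  by rewrite -[X in (_ < X)%N](size_tuple x) index_mem.
exists (Ordinal ix); last by rewrite (tnth_nth (y : R)) /= nth_index.
apply/forallP => k; apply/implyP => /= kx.
rewrite !(tnth_nth (y : R)) /= nth_index//.
by have := before_find (y : R) kx; rewrite /= => ->.
Qed.

Lemma pointsE x : points x = [set tnth x i | i in [set` first_occ x]].
Proof.
apply/seteqP; split => [y /points_first_occ[i xi <-]|_ [i _ <-]].
  by exists i.
exact: mem_tnth.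
Qed.

Lemma measurable_neq (k l : 'I_n) :
  measurable [set x : n.-tuple RT | (tnth x k : R) != tnth x l].
Proof.
have m k' : measurable_fun setT (fun x : n.-tuple RT => tnth x k' : R).
  exact: measurable_tnth.
have := measurable_fun_eqr (m k) (m l) => /= mb.
have := mb measurableT [set false] I.
rewrite setTI; set A := _ @^-1` _; move=> mA.
rewrite (_ : mkset _ = A)//; apply/seteqP; split => x; rewrite /A /=.
  by case: eqP.
by move=> ->.
Qed.

Lemma measurable_first_occ i : measurable [set x | first_occ x i].
Proof.
have -> : [set x | first_occ x i] =
    \bigcap_(k in [set k : 'I_n | (k < i)%N])
      [set x : n.-tuple RT | (tnth x k : R) != tnth x i].
  apply/seteqP; split => x /=.
    by move=> /forallP H k /= ki; have /implyP := H k; exact.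
  by move=> H; apply/forallP => k; apply/implyP => ki; exact: H.
by apply: fin_bigcap_measurable => // k _; exact: measurable_neq.
Qed.

Lemma counting_points x (B : set RT) :
  counting (points x `&` B) =
  (\sum_i \1_[set x | first_occ x i] x * \1_B (tnth x i))%:E :> \bar R.
Proof.
rewrite counting_esum; last exact/finite_setIl/finite_seq.
rewrite esum_mkcondr pointsE.
rewrite (eq_esum (b := fun y => (\1_B y)%:E)); last first.
  by move=> y _; rewrite indicE; case: ifP.
rewrite esum_fin_image//; last by exact: first_occ_inj.
rewrite big_mkcond; congr EFin; apply: eq_bigr => i _.
case: ifPn => xi; rewrite [in RHS]indicE; first by rewrite mem_set ?mul1r.
by rewrite memNset ?mul0r//=; exact/negP.
Qed.

(** All the positions selected by [s] are first occurrences. *)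
Definition first_occs m x (s : {ffun 'I_m -> 'I_n}) := [forall i, first_occ x (s i)].

Lemma distinct_tuplesE m x : distinct_tuples (m := m) (points x) =
  [set tuple_sub s x | s in
    [set` [pred s : {ffun 'I_m -> 'I_n} | injectiveb s & first_occs x s]]].
Proof.
apply/seteqP; split => [t [ut tx]|_ [s /andP[/injectiveP sinj /forallP sx] <-]].
  have /choice[s sP] : forall i, exists k, first_occ x k /\ tnth x k = tnth t i.
    by move=> i; have [k] := points_first_occ (tx i); exists k.
  exists (finfun s); last first.
    by apply: eq_from_tnth => i; rewrite tnth_tuple_sub ffunE; have [] := sP i.
  apply/andP; split; last by apply/forallP => i; rewrite ffunE; have [] := sP i.
  apply/injectiveP => i j; rewrite !ffunE => sij; apply/(tuple_uniqP _ ut).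
  by have [_ <-] := sP i; have [_ <-] := sP j; rewrite sij.
split; last by move=> i; rewrite tnth_tuple_sub; exact: mem_tnth.
apply/tuple_uniqP => i j; rewrite !tnth_tuple_sub => sij; apply: sinj.
by apply: (first_occ_inj _ _ sij); exact: sx.
Qed.

(** A sum over the distinct tuples of points of [x] is a finite sum over the
    injections of the [m] places into the [n] positions. *)
Lemma esum_distinct_tuples m x (f : m.-tuple RT -> R) : (forall t, 0 <= f t) ->
  \esum_(t in distinct_tuples (m := m) (points x)) (f t)%:E =
  (\sum_(s : {ffun 'I_m -> 'I_n} | injectiveb s)
    \1_[set x | first_occs x s] x * f (tuple_sub s x))%:E.
Proof.
move=> f0; rewrite distinct_tuplesE esum_fin_image//; last first.
  move=> s1 s2 /andP[_ /forallP s1x] /andP[_ /forallP s2x] s12; apply/ffunP => i.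
  apply: (first_occ_inj (x := x)) => //; rewrite ?s1x ?s2x//.
    exact: s1x.
    exact: s2x.
  by rewrite -!(tnth_tuple_sub _ x) s12.
rewrite big_mkcondr; congr EFin; apply: eq_bigr => s _.
case: ifPn => xs; rewrite [in RHS]indicE; first by rewrite mem_set ?mul1r.
by rewrite memNset ?mul0r//=; exact/negP.
Qed.

Lemma measurable_first_occs m (s : {ffun 'I_m -> 'I_n}) :
  measurable [set x | first_occs x s].
Proof.
have -> : [set x | first_occs x s] =
    \bigcap_(i in [set: 'I_m]) [set x | first_occ x (s i)].
  apply/seteqP; split => x /= => [/forallP H k _|H]; first exact: H.
  by apply/forallP => k; exact: H.
by apply: fin_bigcap_measurable => // k _; exact: measurable_first_occ.
Qed.

Lemma first_occs_uniq m x (s : {ffun 'I_m -> 'I_n}) : uniq x -> first_occs x s.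
Proof.
move=> ux; apply/forallP => i; apply/forallP => k; apply/implyP => ki.
by apply: contraTneq ki => /(tuple_uniqP _ ux) ->; rewrite ltnn.
Qed.

End point_sums.

(** * Symmetrization over the positions of the variables *)

Section symmetrization.
Context {R : realType}.
Local Notation RT := (measurableTypeR R).

Lemma injection_extends_perm k m (s : {ffun 'I_m -> 'I_(k + m)}) : injectiveb s ->
  exists tau : {perm 'I_(k + m)}, forall i, tau (rshift k i) = s i.
Proof.
move=> /injectiveP sinj.
(* The unused values come first, so that s occupies the last m positions. *)
pose r := enum [predC codom s].
have sr : size r = k.
  rewrite -cardE; have := cardC (mem (codom s)); rewrite card_codom// !card_ord => E.
  by apply/eqP; rewrite -(eqn_add2l m) E addnC.
have st : size (r ++ codom s) == (k + m)%N by rewrite size_cat sr size_codom card_ord.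
have ut : uniq (Tuple st).
  rewrite /= cat_uniq enum_uniq /=; apply/andP; split; last exact/injectiveP.
  by apply/hasPn => i ic; rewrite mem_enum inE /= ic.
have tinj : injective (tnth (Tuple st)) by exact/tuple_uniqP.
exists (perm tinj) => i; rewrite permE (tnth_nth (s i)) /= nth_cat sr.
rewrite ltnNge leq_addr /= addKn.
rewrite (nth_map i) ?size_enum_ord ?ltn_ord//.
by rewrite nth_ord_enum.
Qed.

(** The sum over injections is invariant under permutations of the variables, so
    the density [p] can be replaced in its integral by its symmetrization [V]
    divided by [n!]. Against [V] all the injections contribute equally, as each
    of them is the restriction of a permutation to the last [m] positions. *)
Lemma sum_integral_injections k m (p V : (k + m).-tuple RT -> R)
    (f : m.-tuple RT -> R) :
  measurable_fun setT p -> (forall x, 0 <= p x) ->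
  measurable_fun setT V -> (forall x, 0 <= V x) ->
  (forall (tau : {perm 'I_(k + m)}) x, V (tuple_sub tau x) = V x) ->
  (forall x, \sum_(tau : {perm 'I_(k + m)}) p (tuple_sub tau x) = V x) ->
  measurable_fun setT f -> (forall t, 0 <= f t) ->
  ((k + m)`!%:R%:E * \int[lebesgue_tuple (k + m)]_x
     ((\sum_(s : {ffun 'I_m -> 'I_(k + m)} | injectiveb s) f (tuple_sub s x)) * p x)%:E =
  ((k + m) ^_ m)%:R%:E *
     \int[lebesgue_tuple (k + m)]_x (f (tuple_sub (@rshift k m) x) * V x)%:E)%E.
Proof.
move=> mp p0 mV V0 Vsym pV mf f0.
set n := (k + m)%N in p mp p0 V mV V0 Vsym pV *.
pose h x := \sum_(s : {ffun 'I_m -> 'I_n} | injectiveb s) f (tuple_sub s x).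
have h0 x : 0 <= h x by apply: sumr_ge0.
have mfs s : measurable_fun setT (fun x : n.-tuple RT => f (tuple_sub s x)).
  exact: (measurableT_comp mf (measurable_tuple_sub s)).
have mh : measurable_fun setT h.
  have -> : h = (fun x => \sum_(s : {ffun 'I_m -> 'I_n})
    (if injectiveb s then f (tuple_sub s x) else 0)).
    by apply/funext => x; rewrite /h big_mkcond.
  by apply: measurable_sum => s; case: (injectiveb s).
have hsym (tau : {perm 'I_n}) x : h (tuple_sub tau x) = h x.
  have tinj : injective (fun s : {ffun 'I_m -> 'I_n} => [ffun i => tau (s i)]).
    move=> s1 s2 /ffunP s12; apply/ffunP => i; have := s12 i; rewrite !ffunE.
    exact: perm_inj.
  rewrite /h [RHS](reindex_inj tinj) /=.
  apply: eq_big => s.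
    apply/injectiveP/injectiveP => sinj i j; rewrite ?ffunE.
      by move=> /perm_inj/sinj.
    by move=> sij; apply: sinj; rewrite !ffunE sij.
  move=> _; congr f; apply: eq_from_tnth => i.
  by rewrite !tnth_tuple_sub ffunE.
have mtau (g : n.-tuple RT -> R) (tau : {perm 'I_n}) : measurable_fun setT g ->
    measurable_fun setT (fun x => g (tuple_sub tau x)).
  by move=> mg; exact: measurableT_comp mg (measurable_tuple_sub tau).
transitivity (\int[lebesgue_tuple n]_x (h x * V x)%:E)%E.
  have -> : (\int[lebesgue_tuple n]_x (h x * V x)%:E)%E =
    (\int[lebesgue_tuple n]_x (\sum_(tau : {perm 'I_n}) (h x * p (tuple_sub tau x))%:E)%R)%E.
    by apply: eq_integral => x _; rewrite sumEFin -mulr_sumr pV.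
  rewrite ge0_integral_sum//; last 2 first.
  - by move=> tau; apply/measurable_EFinP; apply: measurable_funM => //; exact: mtau.
  - by move=> tau x _; rewrite lee_fin mulr_ge0.
  under [RHS]eq_bigr => tau _.
    have -> : (\int[lebesgue_tuple n]_x (h x * p (tuple_sub tau x))%:E =
      \int[lebesgue_tuple n]_x (h x * p x)%:E)%E.
      rewrite -[RHS](ge0_integral_lebesgue_tuple_perm tau).
      + by apply: eq_integral => x _; rewrite hsym.
      + by apply/measurable_EFinP; exact: measurable_funM.
      + by move=> x; rewrite lee_fin mulr_ge0.
    over.
  by rewrite sumr_const (card_Sn n) mule_natl.
have -> : (\int[lebesgue_tuple n]_x (h x * V x)%:E)%E =
    (\int[lebesgue_tuple n]_x (\sum_(s <- enum [set s : {ffun 'I_m -> 'I_n} | injectiveb s]%SET)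
       (f (tuple_sub s x) * V x)%:E)%R)%E.
  apply: eq_integral => x _; rewrite sumEFin -mulr_suml; congr (_ * _)%:E.
  by rewrite big_enum; apply: eq_bigl => s; rewrite inE.
have mfV (s : 'I_m -> 'I_n) : measurable_fun setT (fun x => (f (tuple_sub s x) * V x)%:E).
  by apply/measurable_EFinP; exact: measurable_funM.
rewrite ge0_integral_sum//; last first.
  by move=> s x _; rewrite lee_fin mulr_ge0.
rewrite big_enum /=.
have -> : n ^_ m = #|[set s : {ffun 'I_m -> 'I_n} | injectiveb s]%SET|.
  by rewrite card_inj_ffuns !card_ord.
rewrite (eq_bigr (fun=> (\int[lebesgue_tuple n]_x (f (tuple_sub (@rshift k m) x) * V x)%:E)%E)).
  by rewrite sumr_const mule_natl.
move=> s; rewrite inE => /injection_extends_perm[tau tauE].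
rewrite -[RHS](ge0_integral_lebesgue_tuple_perm tau)//; last first.
  by move=> x; rewrite lee_fin mulr_ge0.
apply: eq_integral => x _; rewrite Vsym; congr (f _ * _)%:E.
by apply: eq_from_tnth => i; rewrite !tnth_tuple_sub tauE.
Qed.

End symmetrization.

(** * The density on the Weyl chamber *)

Section chamber.
Context {R : realType} (n : nat).
Local Notation RT := (measurableTypeR R).
Implicit Types x : n.-tuple RT.

Lemma chamber_uniq x : chamber x -> uniq (x : seq R).
Proof.
move=> [_ xlt]; apply/tuple_uniqP => i j xij; apply: val_inj.
have [ij|ji|//] := ltngtP i j.
  by have := xlt i j ij; rewrite xij ltxx.
by have := xlt j i ji; rewrite xij ltxx.
Qed.

Lemma chamber_sorted x : chamber x -> sorted (fun a c : R => c < a) x.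
Proof.
case: x => s ss [_ xlt]; apply/(sortedP 0) => i; rewrite /= (eqP ss) => i1.
by have := xlt (Ordinal (ltnW i1)) (Ordinal i1) (ltnSn i); rewrite !(tnth_nth 0).
Qed.

(** The permutation is the one that sorts the coordinates in decreasing order. *)
Lemma exists_chamber_perm x : (forall i, 0 < (tnth x i : R)) -> uniq (x : seq R) ->
  exists tau : {perm 'I_n}, chamber (tuple_sub tau x).
Proof.
move=> x0 ux; pose ge (a c : R) := c <= a.
have getot : total ge by move=> a c; rewrite /ge orbC le_total.
have getr : transitive ge by move=> a c d ac ca; exact: le_trans ca ac.
have : perm_eq (sort ge (x : seq R)) (x : n.-tuple R) by rewrite perm_sort.
move=> /tuple_permP[tau tauE]; exists tau; split=> [i|i j ij].
  by rewrite tnth_tuple_sub.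
have sE k : (tnth (tuple_sub tau x) k : R) = nth 0 (sort ge (x : seq R)) k.
  by rewrite tauE -(tnth_nth _ (tuple_sub tau x)).
have us : uniq (sort ge (x : seq R)) by rewrite sort_uniq.
have szs : size (sort ge (x : seq R)) = n by rewrite size_sort size_tuple.
rewrite !sE lt_neqAle nth_uniq ?szs// gtn_eqF//=.
have := sorted_ltn_nth getr 0 (sort_sorted getot (x : seq R)).
by move=> /(_ i j); rewrite !inE szs !ltn_ord => /(_ isT isT ij).
Qed.

Lemma chamber_perm_inj x (t1 t2 : {perm 'I_n}) :
  chamber (tuple_sub t1 x) -> chamber (tuple_sub t2 x) -> t1 = t2.
Proof.
move=> c1 c2; have s1 := chamber_sorted c1; have s2 := chamber_sorted c2.
have e : (tuple_sub t1 x : seq R) = tuple_sub t2 x.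
  apply: (irr_sorted_eq _ _ s1 s2).
  - by move=> a c d ac ca; exact: lt_trans ca ac.
  - by move=> a; rewrite ltxx.
  - have mem_sub (t : {perm 'I_n}) : (tuple_sub t x : seq R) =i (x : seq R).
      move=> a; apply/idP/idP => /tnthP[i ->]; first by rewrite tnth_tuple_sub mem_tnth.
      by rewrite -[i](permKV t) -(tnth_tuple_sub t x) mem_tnth.
    by move=> a; rewrite !mem_sub.
have /tuple_uniqP ux := chamber_uniq c1.
apply/permP => i; apply: (@perm_inj _ t1^-1).
rewrite permK; apply: ux; rewrite !tnth_tuple_sub permKV.
have : tnth (tuple_sub t1 x) i = tnth (tuple_sub t2 x) i.
  by rewrite !(tnth_nth (0 : RT)) e.
by rewrite !tnth_tuple_sub.
Qed.

(** The images of the chamber under permutations tile the tuples with distinct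
    positive coordinates. *)
Lemma sum_chamber_perm x : (forall i, 0 < (tnth x i : R)) -> uniq (x : seq R) ->
  \sum_(tau : {perm 'I_n}) \1_(chamber (n := n)) (tuple_sub tau x) = 1 :> R.
Proof.
move=> x0 ux; have [t ct] := exists_chamber_perm x0 ux.
rewrite (bigD1 t)//= indicE mem_set// big1 ?addr0// => s st.
rewrite indicE memNset// => cs; move/eqP: st; apply.
exact: chamber_perm_inj cs ct.
Qed.

End chamber.

Section biorthogonal_gamma_density.
Context {R : realType} (b : R) (n : nat).
Local Notation RT := (measurableTypeR R).
Implicit Types x : n.-tuple RT.

(** The density of the unordered ensemble, up to a constant. It is defined on all
    tuples and vanishes outside the positive orthant. *)
Definition biorth_density x : R :=
  \det (\matrix_(i, k) power_fun b k (tnth x i)) *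
  \det (\matrix_(i, k) log_fun b k (tnth x i)).

Lemma det_weighted_vandermonde (w phi : R -> R) x :
  \det (\matrix_(i < n, k < n) (w (tnth x i) * phi (tnth x i) ^+ k)) =
  (\prod_i w (tnth x i)) *
  \prod_(i < n) \prod_(j < n | (i < j)%N) (phi (tnth x j) - phi (tnth x i)).
Proof.
have -> : \matrix_(i < n, k < n) (w (tnth x i) * phi (tnth x i) ^+ k) =
    diag_mx (\row_i w (tnth x i)) *m (Vandermonde n (\row_i phi (tnth x i)))^T.
  apply/matrixP => i k; rewrite !mxE (bigD1 i)//= big1 ?addr0 => [|j ji].
    by rewrite !mxE eqxx mulr1n.
  by rewrite !mxE eq_sym (negbTE ji) mul0r.
rewrite det_mulmx det_diag det_tr det_Vandermonde; congr (_ * _).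
  by apply: eq_bigr => i _; rewrite mxE.
by apply: eq_bigr => i _; apply: eq_bigr => j _; rewrite !mxE.
Qed.

Lemma biorth_densityE x : biorth_density x =
  (\prod_i half_weight b (tnth x i)) ^+ 2 *
  \prod_(i < n) \prod_(j < n | (i < j)%N)
    (((tnth x i : R) - tnth x j) * (ln (tnth x i : R) - ln (tnth x j : R))).
Proof.
rewrite /biorth_density.
have := det_weighted_vandermonde (half_weight b) id x => /= E1.
have := det_weighted_vandermonde (half_weight b) (@ln R) x => /= E2.
rewrite [X in \det X * _](_ : _ = \matrix_(i < n, k < n)
  (half_weight b (tnth x i) * (tnth x i : R) ^+ k)); last by apply/matrixP => i j; rewrite !mxE.
rewrite [X in _ * \det X](_ : _ = \matrix_(i < n, k < n)
  (half_weight b (tnth x i) * (ln (tnth x i : R)) ^+ k)); last by apply/matrixP => i j; rewrite !mxE.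
rewrite E1 E2 mulrACA -expr2; congr (_ * _).
rewrite -big_split; apply: eq_bigr => i _; rewrite -big_split; apply: eq_bigr => j _ /=.
by rewrite -mulrNN !opprB.
Qed.

Lemma biorth_density_ge0 x : 0 <= biorth_density x.
Proof.
have [x0|/existsNP[i /negP]] := pselect (forall i, 0 < (tnth x i : R)); last first.
  rewrite -leNgt => xi; rewrite biorth_densityE (bigD1 i)//=.
  by rewrite half_weight_le0// mul0r expr0n mul0r.
rewrite biorth_densityE mulr_ge0 ?sqr_ge0//.
apply: prodr_ge0 => i _; apply: prodr_ge0 => j _.
have [xij|xji] := leP (tnth x i : R) (tnth x j).
  by rewrite mulr_le0// subr_le0// ler_ln// posrE.
by rewrite mulr_ge0// subr_ge0 ?ler_ln ?posrE// ltW.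
Qed.

Lemma biorth_density_sym (tau : {perm 'I_n}) x :
  biorth_density (tuple_sub tau x) = biorth_density x.
Proof.
rewrite /biorth_density.
have E (u : 'I_n -> RT -> R) :
    \det (\matrix_(i, k) u k (tnth (tuple_sub tau x) i)) =
    (-1) ^+ tau * \det (\matrix_(i, k) u k (tnth x i)).
  have -> : \matrix_(i, k) u k (tnth (tuple_sub tau x) i) =
    row_perm tau (\matrix_(i, k) u k (tnth x i)).
    by apply/matrixP => i k; rewrite !mxE tnth_tuple_sub.
  by rewrite row_permE det_mulmx det_perm.
by rewrite !E mulrACA -expr2 sqrr_sign mul1r.
Qed.

Lemma biorth_density_nuniq x : ~~ uniq (x : seq R) -> biorth_density x = 0.
Proof.
move=> /tuple_uniqP/existsNP[i /existsNP[j /not_implyP[xij /eqP ij]]].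
have xij' : (tnth x i : RT) = tnth x j by exact: xij.
by rewrite /biorth_density (determinant_alternate ij) ?mul0r// => k; rewrite !mxE xij'.
Qed.

(** The normalizing constant in front of the density on the chamber. *)
Definition density_const : R :=
  (\prod_(1 <= j < n) (j`!)%:R)^-1 * (Gamma b ^+ n)^-1.

Lemma density_const_ge0 : 0 <= density_const.
Proof.
rewrite mulr_ge0// invr_ge0; first by apply: prodr_ge0.
rewrite exprn_ge0//; apply: Rintegral_ge0 => x _.
by rewrite mulr_ge0 ?powR_ge0 ?expR_ge0.
Qed.

Lemma log_densityE x :
  log_density b x = density_const * biorth_density x * \1_(chamber (n := n)) x.
Proof.
rewrite /log_density indicE; have [cx|cx] := boolP (x \in chamber (n := n)); last by rewrite !mulr0.
have [x0 _] := set_mem cx.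
rewrite !mulr1 biorth_densityE [RHS]mulrA; congr (_ * _).
rewrite -[LHS]mulrA; congr (_ * _).
rewrite -prodrXl -sumrN expR_sum -big_split; apply: eq_bigr => i _ /=.
by rewrite half_weight_sqr// mulrC.
Qed.

Lemma log_density_ge0 x : 0 <= log_density b x.
Proof.
rewrite log_densityE indicE; apply: mulr_ge0; last exact: ler0n.
by apply: mulr_ge0; [exact: density_const_ge0|exact: biorth_density_ge0].
Qed.

(** Where some coordinates agree or are not positive, both sides vanish. *)
Lemma sum_log_density_perm x :
  \sum_(tau : {perm 'I_n}) log_density b (tuple_sub tau x) =
  density_const * biorth_density x.
Proof.
under eq_bigr do rewrite log_densityE biorth_density_sym.
rewrite -mulr_sumr.
have [x0|/existsNP[i /negP]] := pselect (forall i, 0 < (tnth x i : R)); last first.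
  rewrite -leNgt => xi; rewrite biorth_densityE (bigD1 i)//=.
  by rewrite half_weight_le0// mul0r expr0n !(mul0r, mulr0).
have [ux|/biorth_density_nuniq->] := boolP (uniq (x : seq R)).
  by rewrite sum_chamber_perm// mulr1.
by rewrite !(mul0r, mulr0).
Qed.

Lemma measurable_biorth_density : measurable_fun setT biorth_density.
Proof.
apply: measurable_funM; apply: measurable_det => i j; under eq_fun do rewrite mxE.
- exact: measurableT_comp (measurable_power_fun _ _) (measurable_tnth i).
- exact: measurableT_comp (measurable_log_fun _ _) (measurable_tnth i).
Qed.

End biorthogonal_gamma_density.

(** * Correlation functions of the ensemble *)

Section log_kernel_theory.
Context {R : realType} (b : R) (b_gt0 : 0 < b) (n : nat).
Local Notation RT := (measurableTypeR R).
Local Notation mu := (@lebesgue_measure R).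
Local Notation K := (biorth_kernel (power_fun b (n := n)) (log_fun b (n := n))).

(** Restricted to positive arguments, where [half_weight] is not truncated. *)
Lemma log_kernelE x y : 0 < x -> 0 < y -> log_kernel b n x y = K x y.
Proof.
move=> x0 y0; rewrite /log_kernel /biorth_kernel gram_power_log mulr_sumr.
apply: eq_bigr => j _; rewrite mulr_sumr; apply: eq_bigr => k _.
rewrite /power_fun /log_fun /half_weight !indicE !mem_set /= ?in_itv /= ?x0 ?y0//.
rewrite powRM ?ltW// (_ : - ((x + y) / 2) = - (x / 2) + - (y / 2)) ?expRD; last by field.
ring.
Qed.

Lemma det_log_kernel m (t : m.-tuple RT) : pos_orthant (m := m) t ->
  \det (\matrix_(i < m, j < m) log_kernel b n (tnth t i) (tnth t j)) =
  \det (kernel_mx K t).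
Proof.
move=> t0; congr (\det _); apply/matrixP => i j; rewrite !mxE log_kernelE//; exact: t0.
Qed.

(** The row of a nonpositive coordinate is zero. *)
Lemma det_kernel_mx_outside m (t : m.-tuple RT) : ~ pos_orthant (m := m) t ->
  \det (kernel_mx K t) = 0.
Proof.
move=> /existsNP[i /negP]; rewrite -leNgt => ti.
rewrite (expand_det_row _ i) big1// => j _; rewrite mxE /biorth_kernel.
rewrite big1 ?mul0r// => k _; rewrite big1// => l _.
by rewrite /power_fun half_weight_le0// mul0r mulr0.
Qed.

Let int_uv i j := @integrable_power_log R b n i j b_gt0.

Let gram_unit : gram (power_fun b (n := n)) (log_fun b (n := n)) \in unitmx.
Proof. by rewrite gram_power_log log_moment_mx_unit. Qed.

Lemma biorth_density_kernel (x : n.-tuple RT) :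
  biorth_density b x = \det (log_moment_mx b n) * \det (kernel_mx K x).
Proof.
rewrite det_kernel_mx_full gram_power_log -mulrA mulVKf//.
by rewrite -unitfE -unitmxE log_moment_mx_unit.
Qed.

(** The instance [m = 0] of [det_kernel_mx_ge0], with [eps] the determinant
    itself: for [n] points the product is [biorth_density], which is
    nonnegative. *)
Lemma det_log_moment_mx_gt0 : 0 < \det (log_moment_mx b n).
Proof.
rewrite lt_neqAle eq_sym -unitfE -unitmxE log_moment_mx_unit//=.
have := @det_kernel_mx_ge0 R n _ _ int_uv gram_unit (\det (log_moment_mx b n)).
move=> /(_ _ 0%N [tuple] (leq0n n)); rewrite det_mx00 mulr1; apply => t.
by rewrite -biorth_density_kernel biorth_density_ge0.
Qed.

Lemma det_power_log_kernel_ge0 m (t : m.-tuple RT) : (m <= n)%N -> 0 <= \det (kernel_mx K t).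
Proof.
move=> mn; rewrite -[X in _ <= X]mul1r.
apply: (det_kernel_mx_ge0 int_uv gram_unit _ _ mn) => {}t; rewrite mul1r.
by rewrite -(pmulr_rge0 _ det_log_moment_mx_gt0) -biorth_density_kernel biorth_density_ge0.
Qed.

Lemma measurable_det_power_log m :
  measurable_fun setT (fun t : m.-tuple RT => \det (kernel_mx K t)).
Proof.
apply: measurable_det_kernel_mx => i; [exact: measurable_power_fun|exact: measurable_log_fun].
Qed.

End log_kernel_theory.

Section correlation.
Context {R : realType} (b : R) (b_gt0 : 0 < b).
Local Notation RT := (measurableTypeR R).
Local Notation K n := (biorth_kernel (power_fun b (n := n)) (log_fun b (n := n))).

(** The expectation of a sum over distinct [m]-tuples, up to the factor
    [density_const b n * \det (log_moment_mx b n)], which equals [1] as soon as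
    the density is that of a random vector ([density_const_det]). *)
Lemma integral_sum_injections_log_density n m (f : m.-tuple RT -> R) : (m <= n)%N ->
  measurable_fun setT (@log_density R b n) ->
  measurable_fun setT f -> (forall t, 0 <= f t) ->
  (\int[lebesgue_tuple n]_x
     ((\sum_(s : {ffun 'I_m -> 'I_n} | injectiveb s) f (tuple_sub s x)) *
        log_density b x)%:E =
  (density_const b n * \det (log_moment_mx b n))%:E *
     \int[lebesgue_tuple m]_t (f t * \det (kernel_mx (K n) t))%:E)%E.
Proof.
move=> /subnK; move: (n - m)%N => k kmn mp mf f0; subst n.
pose c := density_const b (k + m); pose D := \det (log_moment_mx b (k + m)).
have c0 : 0 <= c := density_const_ge0 b (k + m).
have D0 : 0 < D := det_log_moment_mx_gt0 b_gt0 (k + m).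
have mfK : measurable_fun setT (fun t => (f t * \det (kernel_mx (K (k + m)) t))%:E).
  by apply/measurable_EFinP; apply: measurable_funM => //; exact: measurable_det_power_log.
have mV : measurable_fun setT (fun x : (k + m).-tuple RT => c * biorth_density b x).
  by apply: measurable_funM => //; exact: measurable_biorth_density.
have V0 x : 0 <= c * biorth_density b (x : (k + m).-tuple RT).
  by rewrite mulr_ge0 ?biorth_density_ge0.
have Vsym (tau : {perm 'I_(k + m)}) x :
    c * biorth_density b (tuple_sub tau x) = c * biorth_density b x.
  by rewrite biorth_density_sym.
have H := sum_integral_injections mp (@log_density_ge0 R b (k + m)) mV V0 Vsym
  (@sum_log_density_perm R b (k + m)) mf f0.
(* The factor (k + m)! is cancelled through its inverse in R. *)
have fN0 : ((k + m)`!%:R : R) != 0 by rewrite pnatr_eq0 -lt0n fact_gt0.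
rewrite -[LHS]mul1e -[in LHS](mulVf fN0) EFinM -muleA H.
have -> : (\int[lebesgue_tuple (k + m)]_x
    (f (tuple_sub (@rshift k m) x) * (c * biorth_density b x))%:E =
  (c * D)%:E * \int[lebesgue_tuple (k + m)]_x
    (f (tuple_sub (@rshift k m) x) * \det (kernel_mx (K (k + m)) x))%:E)%E.
  rewrite -ge0_integralZl//; first last.
  - by rewrite lee_fin mulr_ge0// ltW.
  - by move=> x _; rewrite lee_fin mulr_ge0// det_power_log_kernel_ge0.
  - apply/measurable_EFinP; apply: measurable_funM; last exact: measurable_det_power_log.
    exact: measurableT_comp mf (measurable_tuple_sub _).
  apply: eq_integral => x _; rewrite -EFinM biorth_density_kernel//; congr EFin.
  rewrite -/D; ring.
rewrite (integral_det_kernel_mx_shift (@measurable_power_fun R b _)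
  (@measurable_log_fun R b _)
  (fun i j => @integrable_power_log R b (k + m) i j b_gt0) _ _ _ mf f0)//; last 2 first.
- by rewrite gram_power_log log_moment_mx_unit.
- by move=> j t jn; exact: det_power_log_kernel_ge0.
rewrite addnK ffactnn !muleA -!EFinM; congr (_%:E * _)%E.
have := @ffact_fact (k + m) m (leq_addl _ _); rewrite addnK.
move=> /(congr1 (fun z => z%:R : R)).
rewrite natrM => E.
transitivity ((k + m)`!%:R^-1 * (((k + m) ^_ m)%:R * k`!%:R) * (c * D)); first by ring.
by rewrite E mulVf// mul1r.
Qed.


Section expectation.
Context (n : nat) (d : measure_display) (T : measurableType d) (P : probability T R)
  (X : {RV P >-> n.-tuple RT}).
Context (Xdens : has_density X (log_density b (n := n))).

Let mp : measurable_fun setT (@log_density R b n) := Xdens.1.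

Lemma expectation_has_density (g : n.-tuple RT -> R) :
  measurable_fun setT g -> (forall x, 0 <= g x) ->
  (\int[P]_w (g (X w))%:E =
   \int[lebesgue_tuple n]_x (g x * log_density b x)%:E)%E.
Proof.
move=> mg g0.
have := @ge0_integral_distribution _ _ _ _ _ P X (EFin \o g).
move=> /(_ _ _)/esym -> //; last exact/measurable_EFinP.
rewrite (@integral_density _ _ _ _ (lebesgue_tuple n) (EFin \o @log_density R b n))//.
- exact/measurable_EFinP.
- exact: Xdens.2.
- exact/measurable_EFinP.
Qed.

(** The density charges only the chamber, where the coordinates are distinct and
    every position is a first occurrence. *)
Lemma expectation_distinct_tuples m (f : m.-tuple RT -> R) :
  measurable_fun setT f -> (forall t, 0 <= f t) ->
  (\int[P]_w (\esum_(t in distinct_tuples (m := m) (points (X w))) (f t)%:E) =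
   \int[lebesgue_tuple n]_x
     ((\sum_(s : {ffun 'I_m -> 'I_n} | injectiveb s) f (tuple_sub s x)) *
        log_density b x)%:E)%E.
Proof.
move=> mf f0.
pose g x := \sum_(s : {ffun 'I_m -> 'I_n} | injectiveb s)
    \1_[set x | first_occs x s] x * f (tuple_sub s x).
under eq_integral do rewrite esum_distinct_tuples//.
rewrite (@expectation_has_density g).
- apply: eq_integral => x _; congr EFin.
  rewrite log_densityE indicE; have [cx|cx] := boolP (x \in chamber (n := n)); last first.
    by rewrite !mulr0.
  congr (_ * _); apply: eq_bigr => s _; rewrite indicE mem_set ?mul1r//=.
  by apply: first_occs_uniq; apply: chamber_uniq; exact: set_mem cx.
- rewrite (_ : g = fun x => \sum_(s : {ffun 'I_m -> 'I_n})
    (if injectiveb s then \1_[set x | first_occs x s] x * f (tuple_sub s x) else 0)).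
    apply: measurable_sum => s; case: (injectiveb s) => //.
    apply: measurable_funM.
      by apply: measurable_indic; exact: measurable_first_occs.
    exact: measurableT_comp mf (measurable_tuple_sub s).
  by apply/funext => x; rewrite /g big_mkcond.
- by move=> x; apply: sumr_ge0 => s _; rewrite mulr_ge0// indicE ler0n.
Qed.

(** The total mass of the density is [1]: the only [0]-tuple of points is the
    empty one. *)
Lemma density_const_det : density_const b n * \det (log_moment_mx b n) = 1.
Proof.
have m1 : measurable_fun setT (cst 1 : 0.-tuple RT -> R) by [].
have := @integral_sum_injections_log_density n 0 (cst 1) (leq0n n) mp m1 (fun=> ler01).
rewrite -expectation_distinct_tuples//.
have D0 w : distinct_tuples (m := 0) (points (X w)) = [set [tuple]].
  apply/seteqP; split => [t _|_ ->] /=; first by rewrite tuple0.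
  by split => // -[].
under eq_integral do rewrite D0 esum_set1//.
rewrite integral_cst//= probability_setT mul1e.
rewrite integral_dirac//; last first.
  by apply/measurable_EFinP; apply: measurable_funM => //; exact: measurable_det_power_log.
by rewrite diracT mul1e det_mx00 mulr1 mule1 => -[].
Qed.

Lemma correlation_function_log_kernel m :
  correlation_function P (fun w => points (X w)) (fun x : m.-tuple RT =>
    \det (\matrix_(i < m, j < m) log_kernel b n (tnth x i) (tnth x j))).
Proof.
split.
  apply: (@eq_measurable_fun _ _ _ _ _ (fun t => \det (kernel_mx (K n) t))).
    by move=> t /set_mem t0; rewrite det_log_kernel.
  by apply: measurable_funTS; exact: measurable_det_power_log.
move=> f mf f0; rewrite expectation_distinct_tuples//.
have -> : (\int[lebesgue_tuple m]_(t in pos_orthant (m := m))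
    (f t * \det (\matrix_(i < m, j < m) log_kernel b n (tnth t i) (tnth t j)))%:E =
  \int[lebesgue_tuple m]_t (f t * \det (kernel_mx (K n) t))%:E)%E.
  rewrite integral_mkcond; apply: eq_integral => t _; rewrite patchE.
  case: ifPn => [/set_mem t0|]; first by rewrite det_log_kernel.
  by rewrite notin_setE => t0; rewrite det_kernel_mx_outside ?mulr0.
have [mn|nm] := leqP m n.
  by rewrite integral_sum_injections_log_density// density_const_det mul1e.
(* There is no injection into a smaller set, and the kernel has rank at most n. *)
rewrite !integral0_eq// => [t|x] _; first by rewrite det_kernel_mx_gt ?mulr0.
rewrite big1 ?mul0r// => s /injectiveP/leq_card; rewrite !card_ord.
by rewrite leqNgt nm.
Qed.

Lemma point_process_points : point_process_pos P (fun w => points (X w)).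
Proof.
split.
- by move=> w a c _; apply: finite_setIl; exact: finite_seq.
- move=> B mB; under eq_fun do rewrite counting_points.
  apply/measurable_EFinP.
  have mg : measurable_fun setT (fun x : n.-tuple RT =>
      \sum_i \1_[set x | first_occ x i] x * \1_B (tnth x i) : R).
    apply: measurable_sum => i; apply: measurable_funM.
      by apply: measurable_indic; exact: measurable_first_occ.
    have mI : measurable_fun setT (\1_B : RT -> R) by exact: measurable_indic.
    exact: (measurableT_comp mI (measurable_tnth i)).
  exact: (measurableT_comp mg (measurable_funPT X)).
- have mpos : measurable (pos_orthant (R := R) (m := n)).
    rewrite (_ : pos_orthant (m := n) = box (fun=> `]0%R, +oo[%classic : set RT)).
      by apply: measurable_box => i; exact: measurable_itv.
    by apply/seteqP; split => x x0 i; move: (x0 i); rewrite /= in_itv /= andbT.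
  exists (X @^-1` ~` pos_orthant (m := n)); split.
  + rewrite -[X in measurable X]setTI; apply: measurable_funP => //.
    exact: measurableC.
  + transitivity (distribution P X (~` pos_orthant (m := n))) => //.
    rewrite Xdens.2; last exact: measurableC.
    apply: integral0_eq => x npos; rewrite log_densityE indicE memNset ?mulr0//.
    by move=> [].
  + move=> w /= nsub pos; apply: nsub => y /= /tnthP[i ->].
    by rewrite in_itv /= andbT; exact: pos.
Qed.

End expectation.
End correlation.

Theorem theorem5 (R : realType) (b : R) (hb : 0 < b) (n : nat) (hn : (0 < n)%N) :
  log_moment_mx b n \in unitmx /\
  forall (d : measure_display) (T : measurableType d) (P : probability T R)
    (X : {RV P >-> n.-tuple (measurableTypeR R)}),
    has_density X (log_density b (n := n)) ->
    determinantal P (fun w => [set x | x \in (X w : seq R)]) (log_kernel b n).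
Proof.
split; first exact: log_moment_mx_unit.
move=> d T P X Xdens; split; first exact: point_process_points Xdens.
by move=> m _; exact: correlation_function_log_kernel.
Qed.
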